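(* Let $t>0$. For any filter $L=J(l_1)\times\cdots\times J(l_d)$, $$\mu_{t}(L^{c})=T(L^{c})=1-\exp(-t\nu(L^{c})),\qquad \tilde{\mu}_{t}(\mathring{L})=T(\mathring{L})=1-\exp(-t\nu(\mathring{L})).$$ The family of exponential distributions associated with $\mu_{t}$, $t>0$ (respectively $\tilde{\mu}_{t}$, $t>0$) has as density function (with respect to $\mu_t$, respectively $\tilde\mu_t$) the hazard function $$h_t(x)=\frac{1}{\mu_{t}(L)}1_{L}(x)=\exp(t\nu(L^{c}))1_{L}(x)$$ (respectively $$\tilde{h}_t(x)=\frac{1}{\tilde{\mu}_{t}(\mathring{L}^{c})}1_{\mathring{L}^{c}}(x)=\exp(t\nu(\mathring{L}))1_{\mathring{L}^{c}}(x)\,).$$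
   Context: Let $X=\{X_t\in\mathbb{R}^d: t\ge 0\}$ be a Lévy process with Lévy measure $\nu$ and jumps $\Delta X_s$. Write $\overline{\mathbb{R}}=[-\infty,+\infty]$, $\overline{\mathbb{R}}^{+}=[0,+\infty]$, $\overline{\mathbb{R}}^{-}=[-\infty,0]$. For $l=(l_1,\ldots,l_d)\in\overline{\mathbb{R}}^d$ put $J(l_i)=[l_i,+\infty]$ if $l_i\ge0$ and $J(l_i)=[-\infty,l_i]$ if $l_i<0$. The filters are the sets $L=J(l_1)\times\cdots\times J(l_d)$; $\mathring{L}$ is the interior of $L$; $\epsilon_i=+$ if $l_i\ge0$, $\epsilon_i=-$ if $l_i<0$; $L^c=\overline{\mathbb{R}}^{\epsilon_1}\times\cdots\times\overline{\mathbb{R}}^{\epsilon_d}\setminus L$ and $\mathring{L}^c=\overline{\mathbb{R}}^{\epsilon_1}\times\cdots\times\overline{\mathbb{R}}^{\epsilon_d}\setminus\mathring{L}$. The operation $*$ is defined coordinatewise by $(x*y)_i=\min(x_i,y_i)$ if $l_i\ge0$ and $\max(x_i,y_i)$ if $l_i<0$; the operation $\tilde *$ by $(x\,\tilde *\,y)_i=\max(x_i,y_i)$ if $l_i\ge0$ and $\min(x_i,y_i)$ if $l_i<0$. The lower record $\wedge_{s\le t}\Delta X_s$ (respectively upper record $\vee_{s\le t}\Delta X_s$) is the composition by $*$ (respectively by $\tilde *$) of the jumps up to time $t$; its distribution is $\mu_t$ (respectively $\tilde\mu_t$). The hitting functional $T(A)=1-\exp(-t\nu(A))$ is the probability that the jumps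 of the Lévy process hit the measurable set $A$ during $[0,t]$. For a semi-character $\chi$ (a nonnegative function with $\chi(x*y)=\chi(x)\chi(y)$) the associated exponential family has density $\chi(x)/E\{\chi(\wedge_{s\le t}\Delta X_s)\}$ with respect to $\mu_t$; here $\chi=1_L$ for $*$, and, with $\tilde *$, $\vee$ and $\tilde\mu_t$ in place of $*$, $\wedge$ and $\mu_t$, $\chi=1_{\mathring{L}^c}$.
   Formalization: The records compose only the jumps lying in the closed orthant of L, and the upper-record half assumes that the indicator of the complement of the interior of L is a semi-character on a sub-semigroup a.s. containing those jumps (automatic for d=1); literally the claims fail otherwise. *)

(* Defs.v *)
From HB Require Import structures.
From mathcomp Require Import all_boot all_order all_algebra.
From mathcomp Require Import all_classical all_reals all_analysis.

Set Implicit Arguments.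
Unset Strict Implicit.
Unset Printing Implicit Defensive.

Import Order.TTheory GRing.Theory Num.Theory.
Import numFieldNormedType.Exports.

Local Open Scope classical_set_scope.
Local Open Scope ring_scope.

Definition borel (T : ptopologicalType) := g_sigma_algebraType (@open T).

Section levy.
Context {R : realType} {d : nat} {dO : measure_display}
  {Omega : measurableType dO}.
Variables (P : probability Omega R) (X : R -> Omega -> 'rV[R]_d).

Definition cadlag (f : R -> 'rV[R]_d) : Prop :=
  (forall t, 0 <= t -> f s @[s --> t^'+] --> f t) /\
  (forall t, 0 < t -> cvg (f s @[s --> t^'-])).

(* The index set is [0, +oo[: the values of X at negative times are junk. *)
Record levy_process : Prop := LevyProcess {
  levy_measurable : forall t, 0 <= t ->
    measurable_fun [set: Omega] (X t : Omega -> borel 'rV[R]_d);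
  levy_start : {ae P, forall w, X 0 w = 0};
  levy_cadlag : forall w, cadlag (X ^~ w);
  levy_independent_increments :
    forall (n : nat) (tau : nat -> R) (A : nat -> set (borel 'rV[R]_d)),
      0 <= tau 0%N -> nondecreasing_seq tau -> (forall i, measurable (A i)) ->
      P (\bigcap_(i in `I_n) [set w | A i (X (tau i.+1) w - X (tau i) w)]) =
      (\prod_(i < n) P [set w | A i (X (tau i.+1) w - X (tau i) w)%R])%E;
  levy_stationary_increments :
    forall (s u : R) (A : set (borel 'rV[R]_d)),
      0 <= s -> 0 <= u -> measurable A ->
      P [set w | A (X (s + u) w - X s w)] = P [set w | A (X u w - X 0 w)];
  levy_stochastically_continuous : forall t e, 0 <= t -> 0 < e ->
    P [set w | e < `|X s w - X t w|]
      @[s --> within [set s | 0 <= s] (nbhs t)] --> 0%E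
}.

(* Meaningful for s > 0 only; there is no jump at time 0. *)
Definition jump (w : Omega) (s : R) : 'rV[R]_d :=
  X s w - lim (X r w @[r --> s^'-]).

Definition jump_times (w : Omega) (t : R) : set R :=
  [set s | 0 < s <= t /\ jump w s != 0].

(* nu A is the expected number of jumps with values in A per unit of time. *)
Definition levy_measure (nu : set (borel 'rV[R]_d) -> \bar R) : Prop :=
  forall A : set (borel 'rV[R]_d), measurable A ->
    nu A = (\int[P]_w counting [set s | jump_times w 1 s /\ A (jump w s)])%E.

End levy.

Definition embed {R : realType} {d : nat} (x : 'rV[R]_d) : 'rV[\bar R]_d :=
  map_mx EFin x.

(* A measure on R^d seen as a measure on [-oo, +oo]^d. *)
Definition extend {R : realType} {d : nat} (nu : set (borel 'rV[R]_d) -> \bar R)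
    (A : set 'rV[\bar R]_d) : \bar R :=
  nu (embed @^-1` A).

Section filters.
Context {R : realType} {d : nat}.
Implicit Types (l x y : 'rV[\bar R]_d) (J : set 'rV[\bar R]_d).
Local Open Scope ereal_scope.

Definition ray (a : \bar R) : set (\bar R) :=
  [set b | if 0 <= a then a <= b else b <= a].

Definition filter_box l : set 'rV[\bar R]_d :=
  [set x | forall i, ray (l ord0 i) (x ord0 i)].

(* The closed orthant with signs epsilon_i: the set in which the complements
   of L and of its interior are taken. *)
Definition orthant l : set 'rV[\bar R]_d :=
  [set x | forall i, if 0 <= l ord0 i then 0 <= x ord0 i else x ord0 i <= 0].

Definition box_compl l : set 'rV[\bar R]_d := orthant l `\` filter_box l.

(* The interior is that of the product topology of [-oo, +oo]^d, so that
   [0, +oo] has interior ]0, +oo] and {+oo} has empty interior. *)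
Definition box_int l : set 'rV[\bar R]_d := (filter_box l)°.

Definition box_int_compl l : set 'rV[\bar R]_d := orthant l `\` box_int l.

Definition star l x y : 'rV[\bar R]_d :=
  \row_i (if 0 <= l ord0 i then mine (x ord0 i) (y ord0 i)
          else maxe (x ord0 i) (y ord0 i)).

Definition tstar l x y : 'rV[\bar R]_d :=
  \row_i (if 0 <= l ord0 i then maxe (x ord0 i) (y ord0 i)
          else mine (x ord0 i) (y ord0 i)).

(* Composition by star of a possibly infinite set J of elements of the orthant;
   the empty composition is the neutral element of star on the orthant, whose
   coordinates are +oo or -oo. *)
Definition star_compose l J : 'rV[\bar R]_d :=
  \row_i (if 0 <= l ord0 i then ereal_inf [set x ord0 i | x in J]
          else ereal_sup [set x ord0 i | x in J]).

(* Same for tstar, whose neutral element on the orthant is 0. *)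
Definition tstar_compose l J : 'rV[\bar R]_d :=
  \row_i (if 0 <= l ord0 i then ereal_sup (0 |` [set x ord0 i | x in J])
          else ereal_inf (0 |` [set x ord0 i | x in J])).

Definition subsemigroup (op : 'rV[\bar R]_d -> 'rV[\bar R]_d -> 'rV[\bar R]_d)
    (E S : set 'rV[\bar R]_d) : Prop :=
  S `<=` E /\ forall x y, S x -> S y -> S (op x y).

Definition semi_character
    (op : 'rV[\bar R]_d -> 'rV[\bar R]_d -> 'rV[\bar R]_d)
    (S : set 'rV[\bar R]_d) (chi : 'rV[\bar R]_d -> R) : Prop :=
  (forall x, S x -> (0 <= chi x)%R) /\
  (forall x y, S x -> S y -> chi (op x y) = (chi x * chi y)%R).

End filters.

Section records.
Context {R : realType} {d : nat} {dO : measure_display}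
  {Omega : measurableType dO}.
Variables (P : probability Omega R) (X : R -> Omega -> 'rV[R]_d).
Variable l : 'rV[\bar R]_d.

(* star and tstar are operations on the orthant of l: only the jumps falling in
   this orthant are composed. *)
Definition orthant_jumps (t : R) (w : Omega) : set 'rV[\bar R]_d :=
  [set embed (jump X w s) | s in jump_times X w t] `&` orthant l.

Definition lower_record (t : R) (w : Omega) : borel 'rV[\bar R]_d :=
  star_compose l (orthant_jumps t w).

Definition upper_record (t : R) (w : Omega) : borel 'rV[\bar R]_d :=
  tstar_compose l (orthant_jumps t w).

Definition lower_law (t : R) : set (borel 'rV[\bar R]_d) -> \bar R :=
  pushforward P (lower_record t).

Definition upper_law (t : R) : set (borel 'rV[\bar R]_d) -> \bar R :=
  pushforward P (upper_record t).

Definition hitting (t : R) (A : set 'rV[\bar R]_d) : \bar R :=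
  P [set w | exists2 s, jump_times X w t s & A (embed (jump X w s))].

(* Density, with respect to the law of the record rho, of the exponential
   distribution of the semi-character chi. In \bar R one has 0^-1 = +oo. *)
Definition exponential_density (chi : 'rV[\bar R]_d -> R)
    (rho : Omega -> borel 'rV[\bar R]_d) (x : borel 'rV[\bar R]_d) : \bar R :=
  ((chi x)%:E / 'E_P[chi \o rho])%E.

End records.

Definition hazard {R : realType} {d : nat}
    (mu : set (borel 'rV[\bar R]_d) -> \bar R) (A : set 'rV[\bar R]_d)
    (x : borel 'rV[\bar R]_d) : \bar R :=
  ((mu A)^-1 * (\1_A x)%:E)%E.

Section tstar_semi_character.
Context {R : realType} {d : nat}.
Implicit Types (l x y : 'rV[\bar R]_d) (S : set 'rV[\bar R]_d).
Local Open Scope ereal_scope.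

Lemma tstarC l x y : tstar l x y = tstar l y x.
Proof. by apply/rowP => i; rewrite !mxE maxC minC. Qed.

Lemma ray_nbhs (a u v : \bar R) : ray a u ->
  (if 0 <= a then maxe u v else mine u v) = v -> v != u ->
  exists2 Q, nbhs v Q & Q `<=` ray a.
Proof.
rewrite /ray; case: ifPn => /= a0 au uv vu.
- exists [set z | u < z]; last by move=> z /= /ltW; exact: le_trans.
  apply: open_nbhs_nbhs; split; first exact: open_ereal_gt_ereal.
  by rewrite /= lt_neqAle eq_sym vu/= -uv le_max lexx.
- exists [set z | z < u].
    apply: open_nbhs_nbhs; split; first exact: open_ereal_lt_ereal.
    by rewrite /= lt_neqAle vu/= -uv ge_min lexx.
  by move=> z /= /ltW zu; exact: le_trans au.
Qed.

Lemma box_int_tstar l x y : box_int l x -> tstar l x y = y -> box_int l y.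
Proof.
move=> lx xy; have xL i : ray (l ord0 i) (x ord0 i).
  exact: (interior_subset lx).
case: lx => V Vx VL.
have Q i : exists2 Q, nbhs (y ord0 i) Q & Q `<=` ray (l ord0 i).
  have [yx|yx] := eqVneq (y ord0 i) (x ord0 i); last first.
    by apply: ray_nbhs yx; [exact: xL|rewrite -[in RHS]xy mxE].
  exists (V ord0 i); first by rewrite yx; exact: Vx.
  move=> z Vz; pose N : 'rV[\bar R]_d := \row_j (if j == i then z else x ord0 j).
  suff /(_ i) : filter_box l N by rewrite mxE eqxx.
  apply: VL => k j; rewrite (ord1 k) mxE; case: eqP => [->//|_].
  exact: nbhs_singleton.
exists (fun _ i => sval (cid2 (Q i))) => [k i|N QN i].
  by rewrite (ord1 k); case: cid2.
by have := QN ord0 i; case: cid2 => /= W _ WL /WL.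
Qed.

(* On a sub-semigroup which is linearly ordered by tstar, in particular on the
   whole orthant when d = 1, the function 1_(box_int_compl l) is a
   semi-character; this fails on the whole orthant when d >= 2 and every
   coordinate of l is finite. *)
Lemma semi_character_total l S : S `<=` orthant l ->
  (forall x y, S x -> S y -> tstar l x y = x \/ tstar l x y = y) ->
  semi_character (tstar l) S \1_(box_int_compl l).
Proof.
move=> Sl tot; split=> [x Sx|]; first by rewrite indicE.
have step x y : S x -> S y -> tstar l x y = y ->
    (\1_(box_int_compl l) y = \1_(box_int_compl l) x * \1_(box_int_compl l) y :> R)%R.
  move=> Sx Sy xy; rewrite !indicE.
  have [yl|] := boolP (y \in box_int_compl l); last by rewrite mulr0.
  rewrite mulr1 mem_set//; split; first exact: Sl.
  by move=> lx; case/set_mem: yl => _; apply; exact: box_int_tstar xy.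
move=> x y Sx Sy; have [xy|xy] := tot x y Sx Sy; rewrite xy; last exact: step.
by rewrite mulrC; apply: step => //; rewrite tstarC.
Qed.

End tstar_semi_character.

Lemma semi_character_dim1 (R : realType) (l : 'rV[\bar R]_1) :
  semi_character (tstar l) (orthant l) \1_(box_int_compl l).
Proof.
apply: semi_character_total => // x y _ _.
have [le_xy|/ltW le_yx] := leP (x ord0 ord0) (y ord0 ord0);
  have [l0|l0] := boolP (0 <= l ord0 ord0)%E.
- by right; apply/rowP => i; rewrite mxE (ord1 i) l0 max_r.
- by left; apply/rowP => i; rewrite mxE (ord1 i) (negbTE l0) min_l.
- by left; apply/rowP => i; rewrite mxE (ord1 i) l0 max_l.
- by right; apply/rowP => i; rewrite mxE (ord1 i) (negbTE l0) min_r.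
Qed.

(* Main.v *)
Require Import Defs.
From HB Require Import structures.
From mathcomp Require Import all_boot all_order all_algebra finmap.
From mathcomp Require Import all_classical all_reals all_analysis.
From mathcomp Require Import measurable_realfun borel_hierarchy ring lra.

Set Implicit Arguments.
Unset Strict Implicit.
Unset Printing Implicit Defensive.

Import Order.TTheory GRing.Theory Num.Theory.
Import numFieldNormedType.Exports.

Local Open Scope classical_set_scope.
Local Open Scope ring_scope.

(** Let [N] be the number of jumps in a set [A], not containing 0, during a time
    interval. Everything rests on [P (N >= 1) = 1 - exp (- h * nu A)] for an
    interval of length [h].

    Let [g h] be the probability that no jump falls in [A] during an interval of
    length [h]. First, [g (m * h) = g h ^ m]. For [A] closed, a path
    jumps into [A] if and only if, for every neighbourhood of [A], all fine enough
    grids have an increment in this neighbourhood ([grid_detects],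
    [grid_misses]); the probability that no increment along a grid hits a given
    set is a power, since increments are independent and stationary, and
    [iterated_limit] passes to the limit ([miss_closed]). Countable unions of
    closed sets follow by continuity of [P] ([miss_Fsigma]). As [g] is antitone,
    either it vanishes at all positive times or [g h = exp (- c * h)] for some
    finite [c] ([exponential_of_antitone]); put [c = +oo] in the first case.

    It remains to see that [c] is the expected number of jumps [nu A]. In the
    subdivision of [[0, 1]] into [n] intervals, the number of intervals
    containing a jump in [A] is at most the number of these jumps, and tends to
    it ([cvg_occupied_cells]); its expectation is [n (1 - g (1 / n))], which
    tends to [c] ([cvg_scaled_expR]). Hence [probability_hit_exp].

    This applies to the complement of the filter and to its interior, since a
    locally closed set of vectors is a countable union of closed sets. The lower
    record leaves the filter exactly when one of the jumps does
    ([lower_record_compl]). The upper record may enter the interior thanks to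
    several jumps, one for each coordinate; but if the indicator of the
    complement is a semi-character on a sub-semigroup almost surely containing
    the jumps, then one of them is already in the interior
    ([box_int_upper_record]). The formulas
    for the densities are then the law of the record on two complementary sets. *)

(** * Borel sets of row vectors *)

Section borel_row_vectors.
Context {dO : measure_display} {Omega : measurableType dO}.

Lemma borel_open (T : ptopologicalType) (A : set T) :
  open A -> measurable (A : set (borel T)).
Proof. exact: sub_sigma_algebra. Qed.

Lemma borel_closed (T : ptopologicalType) (A : set T) :
  closed A -> measurable (A : set (borel T)).
Proof.
move=> /closed_openC/borel_open mA.
by rewrite -(setCK A); exact: measurableC.
Qed.

(** The topology of a product of finitely many spaces with a countable base is
    generated by countably many boxes, so its Borel sets are generated by the
    coordinates. *)
Lemma measurable_rV (T : ptopologicalType) (n : nat) (I : countType)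
    (B : I -> set T) (f : Omega -> 'rV[T]_n) :
  (forall x U, nbhs x U -> exists i, B i x /\ B i `<=` U) ->
  (forall j i, measurable [set w | B i (f w ord0 j)]) ->
  measurable_fun setT (f : Omega -> borel 'rV[T]_n).
Proof.
move=> basisB mB; apply: (@measurability _ _ Omega (borel 'rV[T]_n) setT f
  (@open 'rV[T]_n)) => //.
move=> _ [U /= oU <-]; rewrite setTI.
pose box (g : {ffun 'I_n -> I}) : set 'rV[T]_n :=
  [set v | forall j, B (g j) (v ord0 j)].
rewrite (_ : _ @^-1` _ =
    \bigcup_(g in [set g | box g `<=` U]) (f @^-1` box g)); last first.
  apply/seteqP; split=> [w Uw|w [g /= gU]]; last exact: gU.
  have [P Pfw PU] : nbhs (f w) U by apply: open_nbhs_nbhs.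
  have /choice[g gP] : forall j, exists i, B i (f w ord0 j) /\ B i `<=` P ord0 j.
    by move=> j; apply: basisB; exact: Pfw.
  exists [ffun j => g j] => [v vg|j]; last by rewrite ffunE; case: (gP j).
  apply: PU => i j; rewrite (ord1 i); apply: (gP j).2.
  by move: (vg j); rewrite ffunE.
rewrite bigcup_mkcond; apply: countable_bigcupT_measurable => [|g].
  exact: countableP.
case: ifP => // _; rewrite (_ : _ @^-1` _ =
    \bigcap_(j in [set: 'I_n]) [set w | B (g j) (f w ord0 j)]); last first.
  by apply/seteqP; split=> w wP j => [_|]; exact: wP.
by apply: fin_bigcap_measurable => // j _; exact: mB.
Qed.

(** The open intervals with rational ends form a countable base. *)
Lemma measurable_rV_real (R : realType) n (f : Omega -> 'rV[R]_n) :
  (forall j, measurable_fun setT (fun w => f w ord0 j)) ->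
  measurable_fun setT (f : Omega -> borel 'rV[R]_n).
Proof.
move=> mf; pose B (pq : rat * rat) : set R := `]ratr pq.1, ratr pq.2[%classic.
apply: (measurable_rV (B := B)) => [x U|j pq]; last first.
  by rewrite -[X in measurable X]setTI; apply: mf => //; exact: measurable_itv.
move=> /nbhs_ballP[e /= e0 eU].
have /rat_in_itvoo[p /itvP pP] : x - e < x by rewrite ltrBlDr ltrDl.
have /rat_in_itvoo[q /itvP qP] : x < x + e by rewrite ltrDl.
exists (p, q); split; first by rewrite /B /= in_itv/= pP qP.
move=> y; rewrite /B /= in_itv/= => /andP[py yq]; apply: eU.
rewrite /ball/= distrC ltr_distl.
by rewrite (le_lt_trans _ py) ?pP// (lt_le_trans yq) ?qP.
Qed.

Lemma measurable_rV_ereal (R : realType) n (f : Omega -> 'rV[\bar R]_n) :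
  (forall j, measurable_fun setT (fun w => f w ord0 j)) ->
  measurable_fun setT (f : Omega -> borel 'rV[\bar R]_n).
Proof.
move=> mf.
(* [None] stands for an infinite end, so that the neighbourhoods of +oo and
   -oo are covered too. *)
pose lo (a : option rat) : itv_bound (\bar R) :=
  if a is Some p then BRight (ratr p)%:E%E else -oo%O.
pose hi (a : option rat) : itv_bound (\bar R) :=
  if a is Some p then BLeft (ratr p)%:E%E else +oo%O.
pose B (pq : option rat * option rat) : set (\bar R) :=
  [set` Interval (lo pq.1) (hi pq.2)].
apply: (measurable_rV (B := B)) => [x U|j pq]; last first.
  by rewrite -[X in measurable X]setTI; apply: mf => //; exact: emeasurable_itv.
have above (M : R) : exists p : rat, M < ratr p.
  have /rat_in_itvoo[p /itvP pP] : M < M + 1 by rewrite ltrDl.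
  by exists p; rewrite pP.
have below (M : R) : exists p : rat, ratr p < M.
  have /rat_in_itvoo[p /itvP pP] : M - 1 < M by rewrite ltrBlDr ltrDl.
  by exists p; rewrite pP.
case: x => [x /nbhs_EFin/nbhs_ballP[e /= e0 eU]|[M [_ MU]]|[M [_ MU]]].
- have /rat_in_itvoo[p /itvP pP] : x - e < x by rewrite ltrBlDr ltrDl.
  have /rat_in_itvoo[q /itvP qP] : x < x + e by rewrite ltrDl.
  exists (Some p, Some q); split.
    by rewrite /B /lo /hi /= in_itv/= !lte_fin pP qP.
  move=> y; rewrite /B /= in_itv/= => /andP[].
  case: y => [y| |]//; rewrite !lte_fin => py yq; apply: eU.
  rewrite /ball/= distrC ltr_distl.
  by rewrite (le_lt_trans _ py) ?pP// (lt_le_trans yq) ?qP.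
- have [p Mp] := above M; exists (Some p, None); split.
    by rewrite /B /lo /hi /= in_itv/= ltry.
  move=> y; rewrite /B /lo /hi /= in_itv/= andbT => py; apply: MU.
  by rewrite (lt_trans _ py)// lte_fin.
- have [p Mp] := below M; exists (None, Some p); split.
    by rewrite /B /lo /hi /= in_itv/= ltNyr.
  move=> y; rewrite /B /lo /hi /= in_itv/= => py; apply: MU.
  by rewrite (lt_trans py)// lte_fin.
Qed.

Lemma measurable_borel_coord (R : realType) n (f : Omega -> 'rV[R]_n) j :
  measurable_fun setT (f : Omega -> borel 'rV[R]_n) ->
  measurable_fun setT (fun w => f w ord0 j).
Proof.
move=> mf; apply: (measurability _ (RGenOpens.measurableE R)).
move=> _ [_ [a [b ->] <-]]; rewrite setTI.
have oU : open [set v : 'rV[R]_n | `]a, b[%classic (v ord0 j)].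
  apply: (open_comp (f := fun v : 'rV[R]_n => v ord0 j)).
    by move=> v _; exact: coord_continuous.
  exact: interval_open.
by rewrite -[X in measurable X]setTI; apply: (mf _ _ (borel_open oU)).
Qed.

Lemma measurable_borelB (R : realType) n (f g : Omega -> 'rV[R]_n) :
  measurable_fun setT (f : Omega -> borel 'rV[R]_n) ->
  measurable_fun setT (g : Omega -> borel 'rV[R]_n) ->
  measurable_fun setT ((fun w => f w - g w) : Omega -> borel 'rV[R]_n).
Proof.
move=> mf mg; apply: measurable_rV_real => j.
under eq_fun do rewrite !mxE.
by apply: measurable_funB; exact: measurable_borel_coord.
Qed.

End borel_row_vectors.

(** * Increments of a cadlag path *)

Section cadlag_paths.
Context {R : realType} {d : nat}.
Implicit Types (x : R -> 'rV[R]_d) (A U : set 'rV[R]_d)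
  (a b s p q e r : R).

Definition path_jump x (s : R) := x s - lim (x r @[r --> s^'-]).

Lemma cadlag_right x s e : cadlag x -> 0 <= s -> 0 < e ->
  exists2 r, 0 < r & forall q, s <= q < s + r -> `|x q - x s| < e.
Proof.
move=> [+ _] s0 e0 => /(_ _ s0)/cvgrPdist_lt/(_ _ e0)[r /= r0 rP].
exists r => // q /andP[]; rewrite le_eqVlt => /orP[/eqP->|sq qr].
  by rewrite subrr normr0.
rewrite distrC; apply: rP => //=; rewrite distrC ger0_norm ?subr_ge0 ?ltW//.
by rewrite ltrBlDl.
Qed.

Lemma cadlag_left x s e : cadlag x -> 0 < s -> 0 < e ->
  exists2 r, 0 < r & forall p, s - r < p < s ->
    `|x p - lim (x r @[r --> s^'-])| < e.
Proof.
move=> [_ +] s0 e0 => /(_ _ s0)/cvgrPdist_lt/(_ _ e0)[r /= r0 rP].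
exists r => // p /andP[rp ps].
rewrite distrC; apply: rP => //=; rewrite ger0_norm ?subr_ge0 ?ltW//.
by rewrite ltrBlDl -ltrBlDr.
Qed.

Lemma increment_across_jump x s e : cadlag x -> 0 < s -> 0 < e ->
  exists2 r, 0 < r & forall p q, s - r < p < s -> s <= q < s + r ->
    `|x q - x p - path_jump x s| < e.
Proof.
move=> cx s0 e0; have e20 : 0 < e / 2 by rewrite divr_gt0.
have [r1 r10 rP1] := cadlag_right cx (ltW s0) e20.
have [r2 r20 rP2] := cadlag_left cx s0 e20.
exists (Num.min r1 r2); first by rewrite lt_min r10.
move=> p q /andP[rp ps] /andP[sq qr].
rewrite (_ : _ - _ - _ = (x q - x s) - (x p - lim (x r @[r --> s^'-]))).
  rewrite (splitr e); apply: le_lt_trans (ler_normB _ _) (ltrD _ _).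
    by apply: rP1; rewrite sq (lt_le_trans qr)// lerD2l ge_min lexx.
  by apply: rP2; rewrite ps (le_lt_trans _ rp)// lerD2l lerN2 ge_min lexx orbT.
by rewrite /path_jump !opprB addrACA [RHS]addrACA [- x p + _]addrC.
Qed.

Lemma increment_after x s e : cadlag x -> 0 <= s -> 0 < e ->
  exists2 r, 0 < r & forall p q, s <= p < s + r -> s <= q < s + r ->
    `|x q - x p| < e.
Proof.
move=> cx s0 e0; have e20 : 0 < e / 2 by rewrite divr_gt0.
have [r r0 rP] := cadlag_right cx s0 e20.
exists r => // p q ps qs; rewrite (splitr e) -(subrKA (x s)).
apply: le_lt_trans (ler_normD _ _) (ltrD (rP _ qs) _).
by rewrite distrC; exact: rP.
Qed.

Lemma increment_before x s e : cadlag x -> 0 < s -> 0 < e ->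
  exists2 r, 0 < r & forall p q, s - r < p < s -> s - r < q < s ->
    `|x q - x p| < e.
Proof.
move=> cx s0 e0; have e20 : 0 < e / 2 by rewrite divr_gt0.
have [r r0 rP] := cadlag_left cx s0 e20.
exists r => // p q ps qs; rewrite (splitr e) -(subrKA (lim (x r @[r --> s^'-]))).
apply: le_lt_trans (ler_normD _ _) (ltrD (rP _ qs) _).
by rewrite distrC; exact: rP.
Qed.

(** All increments start at [a] or later, so none is across [s] when [s = a]:
    the jump at [a] does not appear, and only jumps on the half-open interval
    [(a, b]] matter to the increments on [[a, b]]. *)
Lemma local_increments x a s e : cadlag x -> 0 <= a -> a <= s -> 0 < e ->
  exists2 r, 0 < r & forall p q, a <= p -> p < q -> s - r < p -> q < s + r ->
    `|x q - x p| < e \/ a < s /\ `|x q - x p - path_jump x s| < e.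
Proof.
move=> cx a0 sa e0; have s0 := le_trans a0 sa.
have [r1 r10 after] := increment_after cx s0 e0.
move: sa; rewrite le_eqVlt => /predU1P[sa|sa].
  by exists r1 => // p q ap pq _ qr; left; apply: after; lra.
have {}s0 := le_lt_trans a0 sa.
have [r2 r20 before] := increment_before cx s0 e0.
have [r3 r30 across] := increment_across_jump cx s0 e0.
exists (Num.min r1 (Num.min r2 r3)); first by rewrite !lt_min r10 r20.
move=> p q ap pq; rewrite ltrBlDr -ltrBlDl => rp; rewrite -ltrBlDl => rq.
move: rp rq; rewrite !lt_min => /and3P[p1 p2 p3] /and3P[q1 q2 q3].
have [ps|sp] := ltP p s; have [qs|sq] := ltP q s.
- by left; apply: before; lra.
- by right; split=> //; apply: across; lra.
- by exfalso; lra.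
- by left; apply: after; lra.
Qed.

(** Near a time where the path does not jump into the closed set [A], small
    increments are close to 0 or to the jump, hence uniformly away from [A];
    compactness of [[a, b]] makes this uniform in time. *)
Lemma increments_away x A a b : cadlag x -> 0 <= a -> closed A -> ~ A 0 ->
  (forall s, a < s <= b -> ~ A (path_jump x s)) ->
  exists2 r, 0 < r & forall p q, a <= p -> p < q -> q <= b -> q - p < r ->
    forall y, A y -> r <= `|x q - x p - y|.
Proof.
move=> cx a0 cA A0 Aj.
have away v : ~ A v -> exists2 e, 0 < e & forall u, `|u - v| < e ->
    forall y, A y -> e <= `|u - y|.
  move=> Av; have : nbhs v (~` A).
    by apply: open_nbhs_nbhs; split => //; exact: closed_openC.
  move=> /nbhs_ballP[e /= e0 eA]; exists (e / 2); first by rewrite divr_gt0.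
  move=> u uv y Ay; rewrite leNgt; apply/negP => uy.
  apply: (eA y) => //; rewrite -ball_normE/= (splitr e) -(subrKA u).
  by apply: le_lt_trans (ler_normD _ _) (ltrD _ uy); rewrite distrC.
pose good (r p : R) := forall q, a <= p -> p < q -> q <= b -> q - p < r ->
  forall y, A y -> r <= `|x q - x p - y|.
suff : \forall r \near 0^'+, [set` `[a, b]] `<=` good r.
  move=> near_good.
  have [r [r0 rP]] : exists r, 0 < r /\ [set` `[a, b]] `<=` good r.
    apply: (@filter_ex _ (0 : R)^'+); near=> r; split; last by near: r.
    by near: r; exact: nbhs_right_gt.
  exists r => // p q ap pq qb qr y Ay; apply: (rP p) => //=.
  by rewrite in_itv/= ap (le_trans _ qb)// ltW.
have /compact_near_coveringP := @segment_compact R a b.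
apply=> s /=; rewrite in_itv/= => /andP[sa sb].
have [e1 e10 eP1] := away _ A0.
have [e [e0 ee1 eP]] : exists e, [/\ 0 < e, e <= e1 & a < s ->
    forall u, `|u - path_jump x s| < e -> forall y, A y -> e <= `|u - y|].
  have [sa'|sa'] := ltP a s; last by exists e1.
  have [e2 e20 eP2] : exists2 e, 0 < e & forall u, `|u - path_jump x s| < e ->
      forall y, A y -> e <= `|u - y|.
    by apply: away; apply: Aj; rewrite sa'.
  exists (Num.min e1 e2); split.
  - by rewrite lt_min e10.
  - by rewrite ge_min lexx.
  - move=> _ u; rewrite lt_min => /andP[_ /eP2 + y Ay] => /(_ y Ay).
    by rewrite ge_min orbC => ->.
have [r r0 rP] := local_increments cx a0 sa e0.
have r20 : 0 < r / 2 by rewrite divr_gt0.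
near=> p k => q /= ap pq qb qk y Ay.
have kr : k < r / 2 by near: k; exact: nbhs_right_lt.
have ke : k <= e by near: k; exact: nbhs_right_le.
have sp : `|s - p| < r / 2.
  by near: p; apply/nbhs_ballP; exists (r / 2).
apply: le_trans ke _; move: sp; rewrite ltr_norml => /andP[sp1 sp2].
have [small|[sa' /(eP sa')]] := rP p q ap pq ltac:(lra) ltac:(lra); last exact.
apply: (le_trans ee1); apply: eP1 Ay.
by rewrite subr0 (lt_le_trans small).
Unshelve. all: by end_near. Qed.

End cadlag_paths.

(** * Iterated limits of probabilities *)

Section iterated_limit.

(** Convergence along this filter is the iterated limit, first in the second
    index. The rate of the inner limit depends on the path, so the events
    considered along a diagonal sequence need not converge pathwise. *)
Definition iterated_oo : set_system (nat * nat) :=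
  [set S | \forall j \near \oo, \forall n \near \oo, S (j, n)].

Global Instance iterated_oo_filter : ProperFilter iterated_oo.
Proof.
split.
  move=> -[j _ jP]; have [n _ nP] := jP j (leqnn _).
  exact: nP (leqnn n).
split.
- by apply: nearW => j; apply: nearW.
- move=> S T; rewrite /iterated_oo /= => Sn Tn.
  by apply: filterS2 Sn Tn => j; exact: filterS2.
- move=> S T ST; rewrite /iterated_oo /= => Sn.
  by apply: filterS Sn => j; apply: filterS => n; exact: ST.
Qed.

Context {R : realType} {dO : measure_display} {Omega : measurableType dO}.
Variable P : probability Omega R.
Implicit Types (N : set Omega) (F : nat -> set Omega).

Lemma cvg_probability_bigcup F : (forall n, measurable (F n)) ->
  nondecreasing_seq F -> fine (P (F n)) @[n --> \oo] --> fine (P (\bigcup_n F n)).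
Proof.
move=> mF ndF; apply: fine_cvg; rewrite fineK ?fin_num_measure//.
  by apply: nondecreasing_cvg_mu => //; exact: bigcupT_measurable.
exact: bigcupT_measurable.
Qed.

Lemma cvg_probability_bigcap F : (forall n, measurable (F n)) ->
  nonincreasing_seq F -> fine (P (F n)) @[n --> \oo] --> fine (P (\bigcap_n F n)).
Proof.
move=> mF niF; apply: fine_cvg; rewrite fineK ?fin_num_measure//.
  apply: nonincreasing_cvg_mu => //; last exact: bigcapT_measurable.
  by rewrite (le_lt_trans (probability_le1 _ _))// ltry.
exact: bigcapT_measurable.
Qed.

Lemma le_fine_probability A B : measurable A -> measurable B -> A `<=` B ->
  fine (P A) <= fine (P B).
Proof.
by move=> mA mB AB; rewrite fine_le ?fin_num_measure// le_measure ?inE.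
Qed.

(** The sets [liminf_n (M j n)] increase to [N], and no [limsup_n (M j n)]
    exceeds [N], so continuity of [P] along monotone sequences bounds the
    iterated limit of the probabilities from both sides. *)
Lemma iterated_limit N (M : nat -> nat -> set Omega) :
  (forall j n, measurable (M j n)) ->
  (forall n, nondecreasing_seq (M ^~ n)) ->
  (forall w, N w -> exists j, \forall n \near \oo, M j n w) ->
  (forall w, ~ N w -> forall j, \forall n \near \oo, ~ M j n w) ->
  measurable N /\ fine (P (M x.1 x.2)) @[x --> iterated_oo] --> fine (P N).
Proof.
move=> mM ndM inN outN.
pose Lo j m := \bigcap_(n in [set n | (m <= n)%N]) M j n.
pose Up j m := \bigcup_(n in [set n | (m <= n)%N]) M j n.
have mLo j m : measurable (Lo j m) by apply: bigcap_measurable => //; exists m => /=.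
have mUp j m : measurable (Up j m) by exact: bigcup_measurable.
have ndLo j : nondecreasing_seq (Lo j).
  by move=> m m' mm'; apply/subsetPset => w wP n /= /(leq_trans mm') /wP.
have mLoj j : measurable (\bigcup_m Lo j m) by exact: bigcupT_measurable.
have ndLoj : nondecreasing_seq (fun j => \bigcup_m Lo j m).
  move=> j j' jj'; apply/subsetPset => w [m _ wP]; exists m => // n /= /wP.
  by apply/subsetPset/ndM.
have NE : N = \bigcup_j \bigcup_m Lo j m.
  apply/seteqP; split=> [w /inN[j [m _ jm]]|w [j _ [m _ jm]]].
    by exists j => //; exists m.
  apply: contrapT => /outN/(_ j)[n _ jn].
  by apply: (jn (maxn m n)); rewrite /= ?leq_maxr//; apply: jm; rewrite /= leq_maxl.
have mN : measurable N by rewrite NE; exact: bigcupT_measurable.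
split=> //; apply/cvgrPdist_lt => e e0; have e20 : 0 < e / 2 by rewrite divr_gt0.
have /cvgrPdist_lt/(_ _ e20) := cvg_probability_bigcup mLoj ndLoj.
rewrite -NE => nearN; rewrite /iterated_oo /nbhs /=.
apply: filterS nearN => j jN.
have /cvgrPdist_lt/(_ _ e20) := cvg_probability_bigcup (mLo j) (ndLo j).
have niUp : nonincreasing_seq (Up j).
  by move=> m m' mm'; apply/subsetPset => w [n /= /(leq_trans mm') ? ?]; exists n.
have /cvgrPdist_lt/(_ _ e20) := cvg_probability_bigcap (mUp j) niUp.
have UpN : fine (P (\bigcap_m Up j m)) <= fine (P N).
  apply: le_fine_probability => //; first exact: bigcapT_measurable.
  move=> w wUp; apply: contrapT => /outN/(_ j)[m _ jm].
  by have [n /= mn] := wUp m I; apply: jm.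
apply: filterS2 => n nUp nLo.
have LoM : fine (P (Lo j n)) <= fine (P (M j n)).
  by apply: le_fine_probability => //; move=> w; apply => /=.
have MUp : fine (P (M j n)) <= fine (P (Up j n)).
  by apply: le_fine_probability => //; move=> w; exists n => /=.
move: jN nUp nLo; rewrite !ltr_norml => /andP[? ?] /andP[? ?] /andP[? ?].
by rewrite /=; lra.
Qed.

End iterated_limit.

(** * Increments along a grid *)

Section thickening.
Context {R : realType} {d : nat}.
Implicit Types (A : set 'rV[R]_d) (e : R).

Definition thickening A e : set 'rV[R]_d :=
  [set v | exists2 y, A y & `|v - y| < e].

Lemma open_thickening A e : open (thickening A e).
Proof.
rewrite (_ : thickening A e = \bigcup_(y in A) ball y e).
  by apply: bigcup_open => y _; exact: ball_open.
by apply/seteqP; split=> v [y Ay yv]; exists y => //; move: yv;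
  rewrite -ball_normE/= distrC.
Qed.

Lemma thickening_le A e e' : e <= e' -> thickening A e `<=` thickening A e'.
Proof. by move=> ee' v [y Ay yv]; exists y => //; exact: lt_le_trans ee'. Qed.

Lemma measurable_thickening A e :
  measurable (thickening A e : set (borel 'rV[R]_d)).
Proof. by apply: borel_open; apply: open_thickening. Qed.

End thickening.

Section grids.
Context {R : realType} {d : nat}.
Implicit Types (x : R -> 'rV[R]_d) (A : set 'rV[R]_d) (a h e : R).

Definition grid_point a h (k : nat) : R := a + k%:R * h.

Lemma grid_pointS a h k : grid_point a h k.+1 = grid_point a h k + h.
Proof. by rewrite /grid_point -natr1 mulrDl mul1r addrA. Qed.

Lemma near_small_step h e : 0 < e -> \forall n \near \oo, h / n.+1%:R < e.
Proof.
move=> e0; near=> n; rewrite ltr_pdivrMr// mulrC -ltr_pdivrMr//.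
rewrite (@lt_le_trans _ _ n%:R)// ?ler_nat//; near: n.
exact: nbhs_infty_gtr.
Unshelve. all: by end_near. Qed.

Definition increment x a h (k : nat) :=
  x (grid_point a h k.+1) - x (grid_point a h k).

Lemma grid_end h m n : (m * n.+1)%:R * (h / n.+1%:R) = m%:R * h.
Proof. by rewrite natrM -mulrA [n.+1%:R * _]mulrC divfK// pnatr_eq0. Qed.

(** [[a, a + m * h]] is cut into steps of length [h / n.+1], which does not
    depend on [m]: increments along the grids of intervals of different lengths
    then have the same law. The jump at [s] shows in the cell containing [s],
    whose index is found as the least [k] such that the [k]-th point is not
    before [s]. *)
Lemma grid_detects x A a h m s e : cadlag x -> 0 <= a -> 0 < h -> 0 < e ->
  a < s <= a + m%:R * h -> A (path_jump x s) ->
  \forall n \near \oo, exists2 k, (k < m * n.+1)%N &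
    thickening A e (increment x a (h / n.+1%:R) k).
Proof.
move=> cx a0 h0 e0 /andP[sa sb] As.
have [r r0 rP] := increment_across_jump cx (le_lt_trans a0 sa) e0.
near=> n; have hr : h / n.+1%:R < r by near: n; exact: near_small_step.
have [k sk kmin] : exists2 k, s <= grid_point a (h / n.+1%:R) k &
    forall k', s <= grid_point a (h / n.+1%:R) k' -> (k <= k')%N.
  have sk : exists k, s <= grid_point a (h / n.+1%:R) k.
    exists (m * n.+1)%N.
    by rewrite /grid_point grid_end.
  by exists (ex_minn sk); case: ex_minnP.
case: k sk kmin => [|k] sk kmin.
  by move: sk; rewrite /grid_point mul0r addr0 leNgt sa.
have ks : grid_point a (h / n.+1%:R) k < s.
  by rewrite ltNge; apply/negP => /kmin; rewrite ltnn.
exists k.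
  apply: kmin.
  by rewrite /grid_point grid_end.
exists (path_jump x s) => //; rewrite /increment.
move: hr sk ks; rewrite grid_pointS; set q := grid_point _ _ _; set c := h / _.
by move=> hr sk ks; apply: rP; apply/andP; split; lra.
Unshelve. all: by end_near. Qed.

Lemma grid_misses x A a h m : cadlag x -> 0 <= a -> 0 < h ->
  closed A -> ~ A 0 ->
  (forall s, a < s <= a + m%:R * h -> ~ A (path_jump x s)) ->
  exists2 e, 0 < e & \forall n \near \oo, forall k, (k < m * n.+1)%N ->
    ~ thickening A e (increment x a (h / n.+1%:R) k).
Proof.
move=> cx a0 h0 cA A0 /(increments_away cx a0 cA A0)[r r0 rP].
exists r => //; near=> n => k km [y Ay].
rewrite ltNge; apply/negP; rewrite negbK /increment.
have n0 : 0 < h / n.+1%:R by rewrite divr_gt0.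
apply: rP => //.
- by rewrite /grid_point lerDl mulr_ge0// ltW.
- by rewrite grid_pointS ltrDl.
- rewrite /grid_point lerD2l -(grid_end h m n) ler_wpM2r ?ler_nat//.
  exact: ltW.
- rewrite grid_pointS addrAC subrr add0r; near: n; exact: near_small_step.
Unshelve. all: by end_near. Qed.

End grids.

(** * Multiplicativity of the probability of no jump *)

Lemma cvg_exprn (R : realType) T (F : set_system T) (FF : Filter F) (f : T -> R)
    (l : R) m :
  f x @[x --> F] --> l -> f x ^+ m @[x --> F] --> l ^+ m.
Proof.
by move=> fl; apply: (continuous_cvg (h := fun z : R => z ^+ m) FF _ fl);
  exact: exprn_continuous.
Qed.

Section hits.
Context {R : realType} {d : nat} {dO : measure_display}
  {Omega : measurableType dO}.
Variables (P : probability Omega R) (X : R -> Omega -> 'rV[R]_d).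
Hypothesis hX : levy_process P X.
Implicit Types (A : set 'rV[R]_d) (a b h : R).

(** The interval is open on the left, like the increments [X b - X a], which do
    not see a jump at [a]. *)
Definition hit a b A : set Omega := [set w | exists2 s,
  a < s <= b /\ jump X w s != 0 & A (jump X w s)].

Definition grid_miss A a h m : set Omega := \bigcap_(k in `I_m)
  [set w | (~` A) (increment (X ^~ w) a h k)].

Lemma measurable_increment A a h k : 0 <= a -> 0 <= h ->
  measurable (A : set (borel 'rV[R]_d)) ->
  measurable [set w | A (increment (X ^~ w) a h k)].
Proof.
move=> a0 h0 mA.
have g0 j : 0 <= grid_point a h j by rewrite addr_ge0// mulr_ge0.
have := measurable_borelB (levy_measurable hX (g0 k.+1)) (levy_measurable hX (g0 k)).
by move=> /(_ measurableT _ mA); rewrite setTI.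
Qed.

Lemma measurable_grid_miss A a h m : 0 <= a -> 0 <= h ->
  measurable (A : set (borel 'rV[R]_d)) -> measurable (grid_miss A a h m).
Proof.
move=> a0 h0 mA; apply: fin_bigcap_measurable => // k _.
by apply: measurable_increment => //; exact: measurableC.
Qed.

(** The increments along the grid are independent, and have the law of
    [X h - X 0] by stationarity. *)
Lemma probability_grid_miss A a h m : 0 <= a -> 0 <= h ->
  measurable (A : set (borel 'rV[R]_d)) ->
  fine (P (grid_miss A a h m)) = fine (P (grid_miss A 0 h 1)) ^+ m.
Proof.
move=> a0 h0 mA; have mAc : measurable (~` A : set (borel 'rV[R]_d)).
  exact: measurableC.
have g0 j : 0 <= grid_point a h j by rewrite addr_ge0// mulr_ge0.
have ndg : nondecreasing_seq (grid_point a h).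
  by apply/nondecreasing_seqP => k; rewrite grid_pointS lerDl.
have one : P (grid_miss A 0 h 1) = P [set w | (~` A) (X h w - X 0 w)].
  congr (P _); apply/seteqP; split=> [w /(_ 0%N erefl)|w Aw k /=].
    by rewrite /increment /grid_point /= mul0r mul1r add0r addr0.
  rewrite ltnS leqn0 => /eqP->.
  by rewrite /increment /grid_point /= mul0r mul1r add0r addr0.
have := levy_independent_increments hX m (A := fun=> ~` A) (g0 0%N) ndg (fun=> mAc).
rewrite /grid_miss => ->.
under eq_bigr do rewrite grid_pointS
  (levy_stationary_increments hX (g0 _) h0 mAc) -one.
have m1 : measurable (grid_miss A 0 h 1) by exact: measurable_grid_miss.
rewrite -(@fineK _ (P (grid_miss A 0 h 1))) ?fin_num_measure//.
by rewrite prodEFin/= prodr_const card_ord.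
Qed.

(** The thickenings of [A] shrink to [A] with the first index and the grids get
    finer with the second one. *)
Lemma cvg_grid_miss A a h m : closed A -> ~ A 0 -> 0 <= a -> 0 < h ->
  measurable (~` hit a (a + m%:R * h) A) /\
  fine (P (grid_miss (thickening A x.1.+1%:R^-1) a (h / x.2.+1%:R) (m * x.2.+1)))
    @[x --> iterated_oo] --> fine (P (~` hit a (a + m%:R * h) A)).
Proof.
move=> cA A0 a0 h0.
pose M j n := grid_miss (thickening A j.+1%:R^-1) a (h / n.+1%:R) (m * n.+1).
have hn0 n : 0 <= h / n.+1%:R by rewrite divr_ge0// ltW.
apply: (@iterated_limit _ _ _ P _ M).
- move=> j n; apply: measurable_grid_miss => //.
  exact: measurable_thickening.
- move=> n j j' jj'; apply/subsetPset => w wj k /wj; apply: contra_not.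
  by apply: thickening_le; rewrite lef_pV2 ?posrE// ler_nat.
- move=> w wA.
  have no_jump s : a < s <= a + m%:R * h -> ~ A (path_jump (X ^~ w) s).
    move=> sab As; apply: wA; exists s => //; split => //.
    by apply: contra_notN A0 => /eqP <-.
  have [e e0 near_miss] := grid_misses (levy_cadlag hX w) a0 h0 cA A0 no_jump.
  have [j je] : exists j : nat, j.+1%:R^-1 < e.
    have [j _ /(_ j (leqnn j))] := near_infty_natSinv_lt (PosNum e0).
    by exists j.
  exists j; apply: filterS near_miss => n nP k /nP; apply: contra_not.
  by apply: thickening_le; exact: ltW.
- move=> w /contrapT[s [sab _] As] j.
  have j0 : 0 < j.+1%:R^-1 :> R by rewrite invr_gt0.
  have := grid_detects (levy_cadlag hX w) a0 h0 j0 sab As.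
  by apply: filterS => n [k km kA] /(_ k km).
Qed.

(** Along the same iterated limit, the probability that a grid of
    [m * n.+1] steps misses is the [m]-th power of that for [n.+1] steps. *)
Lemma miss_closed A a h m : closed A -> ~ A 0 -> 0 <= a -> 0 < h ->
  measurable (~` hit a (a + m%:R * h) A) /\
  fine (P (~` hit a (a + m%:R * h) A)) = fine (P (~` hit 0 h A)) ^+ m.
Proof.
move=> cA A0 a0 h0; have [mH cvg_m] := cvg_grid_miss m cA A0 a0 h0; split=> //.
have [_] := cvg_grid_miss 1 cA A0 (lexx 0) h0.
rewrite mul1r add0r => cvg_1.
have : (fine (P (grid_miss (thickening A x.1.+1%:R^-1) 0 (h / x.2.+1%:R)
    (1 * x.2.+1)))) ^+ m @[x --> iterated_oo] --> fine (P (~` hit 0 h A)) ^+ m.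
  exact: cvg_exprn.
apply: cvg_unique => //; apply: cvg_trans cvg_m.
apply: near_eq_cvg; apply: nearW => -[j n] /=.
have hn0 : 0 <= h / n.+1%:R by rewrite divr_ge0// ltW.
have mT : measurable (thickening A j.+1%:R^-1 : set (borel 'rV[R]_d)).
  exact: measurable_thickening.
rewrite mul1n (probability_grid_miss n.+1 (lexx 0) hn0 mT).
by rewrite (probability_grid_miss (m * n.+1) a0 hn0 mT) mulnC exprM.
Qed.

(** Finite unions of the closed pieces of [A] increase to [A], so the events of
    missing them decrease to the event of missing [A]. *)
Lemma miss_Fsigma A a h m : Fsigma A -> ~ A 0 -> 0 <= a -> 0 < h ->
  measurable (~` hit a (a + m%:R * h) A) /\
  fine (P (~` hit a (a + m%:R * h) A)) = fine (P (~` hit 0 h A)) ^+ m.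
Proof.
move=> [F cF AE] A0 a0 h0.
pose C n := \bigcup_(i in `I_n) F i.
have cC n : closed (C n) by apply: closed_bigcup.
have C0 n : ~ C n 0 by move=> [i _ Fi]; apply: A0; rewrite AE; exists i.
have ndC n n' : (n <= n')%N -> C n `<=` C n'.
  by move=> nn' v [i /= ni Fi]; exists i => //=; exact: leq_trans ni nn'.
have missE b c : ~` hit b c A = \bigcap_n ~` hit b c (C n).
  rewrite -setC_bigcup; congr (~` _); apply/seteqP; split.
    move=> w [s sbc]; rewrite AE => -[i _ Fi]; exists i.+1 => //; exists s => //.
    by exists i => /=.
  by move=> w [n _ [s sbc [i _ Fi]]]; exists s => //; rewrite AE; exists i.
have niC b c : nonincreasing_seq (fun n => ~` hit b c (C n)).
  move=> n n' nn'; apply/subsetPset => w; apply: contra_not => -[s sbc Cs].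
  by exists s => //; exact: ndC Cs.
have mm n := (miss_closed m (cC n) (C0 n) a0 h0).1.
have m1 n : measurable (~` hit 0 h (C n)).
  by have := (miss_closed 1 (cC n) (C0 n) (lexx 0) h0).1; rewrite mul1r add0r.
split; first by rewrite missE; exact: bigcapT_measurable.
have : fine (P (~` hit 0 h (C n))) ^+ m @[n --> \oo] --> fine (P (~` hit 0 h A)) ^+ m.
  by apply: cvg_exprn; rewrite missE; exact: cvg_probability_bigcap.
rewrite (_ : (fun n => _ ^+ m) =
    fun n => fine (P (~` hit a (a + m%:R * h) (C n)))); last first.
  by apply/funext => n; rewrite (miss_closed m (cC n) (C0 n) a0 h0).2.
by apply: cvg_unique => //; rewrite missE; exact: cvg_probability_bigcap.
Qed.

End hits.

(** * Counting by occupied cells *)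

Section counting_by_cells.
Context {R : realType}.
Implicit Types (T : set R) (s : R) (n : nat).

Definition cell n (k : nat) : set R := [set s |
  grid_point 0 n.+1%:R^-1 k < s <= grid_point 0 n.+1%:R^-1 k.+1].

Lemma trivIset_cell n (D : set nat) T : trivIset D (fun k => T `&` cell n k).
Proof.
have step0 : 0 <= n.+1%:R^-1 :> R by rewrite invr_ge0.
have disj i j s : (i < j)%N -> cell n i s -> ~ cell n j s.
  move=> ij /andP[_ si] /andP[js _]; have := lt_le_trans js si.
  by rewrite ltNge /grid_point lerD2l ler_wpM2r// ler_nat.
move=> i j _ _ [s [[_ si] [_ sj]]].
by have [/disj/(_ si)|/disj/(_ sj)|//] := ltngtP i j.
Qed.

Lemma bigcup_cell n T : T `<=` `]0, 1]%classic ->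
  T = \bigcup_(k in `I_n.+1) (T `&` cell n k).
Proof.
move=> T01; apply/seteqP; split=> [s Ts|s [k _ []]//].
have := T01 _ Ts; rewrite /= in_itv/= => /andP[s0 s1].
have last_cell : s <= grid_point 0 n.+1%:R^-1 n.+1.
  by rewrite /grid_point add0r divff// pnatr_eq0.
have sk : exists k, s <= grid_point 0 n.+1%:R^-1 k by exists n.+1.
have [k sk' kmin] : exists2 k, s <= grid_point 0 n.+1%:R^-1 k &
    forall k', s <= grid_point 0 n.+1%:R^-1 k' -> (k <= k')%N.
  by exists (ex_minn sk); case: ex_minnP.
case: k sk' kmin => [|k] sk' kmin.
  by move: sk'; rewrite /grid_point mul0r addr0 leNgt s0.
exists k => /=; first exact: kmin.
split=> //; rewrite /cell/= sk' andbT ltNge.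
by apply/negP => /kmin; rewrite ltnn.
Qed.

Definition occupied_cells T n : \bar R :=
  (\sum_(k < n.+1) (if `[< T `&` cell n k !=set0 >] then 1 else 0))%E.

(* The counting measure is a measure on any sigma-algebra; the discrete one
   makes its additivity available for arbitrary sets of times. *)
Let cnt : {measure set (g_sigma_algebraType [set: set R]) -> \bar R} :=
  @counting R R.

Let measurable_all (B : set R) :
  measurable (B : set (g_sigma_algebraType [set: set R])).
Proof. by apply: sub_sigma_algebra. Qed.

Lemma counting_cells T n : T `<=` `]0, 1]%classic ->
  counting T = (\sum_(k < n.+1) counting (T `&` cell n k))%E :> \bar R.
Proof.
move=> T01; pose F (k : 'I_n.+1) := T `&` cell n k.
have tF : trivIset [set: 'I_n.+1] F.
  by move=> i j _ _ Fij; apply/val_inj; exact: (@trivIset_cell n setT T i j I I Fij).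
rewrite [in LHS](bigcup_cell n T01) bigcup_mkord.
exact: (measure_bigsetU_ord cnt xpredT (fun=> measurable_all _) tF).
Qed.

Lemma counting_ge1 T : T !=set0 -> (1 <= counting T :> \bar R)%E.
Proof.
move=> [s Ts]; have <- : counting [set s] = 1%E :> \bar R.
  by rewrite /counting asboolT// fset_set1 cardfs1.
apply: (@le_measure _ _ _ cnt); rewrite ?inE; try exact: measurable_all.
by move=> _ ->.
Qed.

Lemma occupied_cells_le T n : T `<=` `]0, 1]%classic ->
  (occupied_cells T n <= counting T)%E.
Proof.
move=> T01; rewrite (counting_cells n T01); apply: lee_sum => k _.
case: ifPn => [/asboolP/counting_ge1//|_]; exact: (measure_ge0 cnt).
Qed.

Lemma counting_le1 T : (forall s s', T s -> T s' -> s = s') ->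
  (counting T <= if `[< T !=set0 >] then 1 else 0 :> \bar R)%E.
Proof.
move=> T1; have [[s Ts]|T0] := pselect (T !=set0).
  rewrite (_ : T = [set s]); last first.
    by apply/seteqP; split=> [s' Ts'|_ ->//]; exact: T1.
  rewrite asboolT; last by exists s.
  by rewrite /counting asboolT// fset_set1 cardfs1.
rewrite asboolF//; move/set0P/negP : T0; rewrite negbK => /eqP ->.
by rewrite (measure0 cnt).
Qed.

(** Once the cells are shorter than the distances between the elements of [D],
    each of them contains at most one. *)
Lemma le_occupied_cells T (D : {fset R}) :
  T `<=` `]0, 1]%classic -> [set` D] `<=` T ->
  \forall n \near \oo, ((size D)%:R%:E <= occupied_cells T n)%E.
Proof.
move=> T01 DT.
have sep : \forall n \near \oo, forall s s', s \in D -> s' \in D -> s < s' ->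
    n.+1%:R^-1 < s' - s.
  have : \oo (\bigcap_(s in [set` D]) \bigcap_(s' in [set` D])
      [set n | s < s' -> n.+1%:R^-1 < s' - s]).
    apply: (@filter_bigI _ _ D _ \oo) => s sD.
    apply: (@filter_bigI _ _ D _ \oo) => s' s'D.
    have [ss'|ss'] := ltP s s'; last by exists 0%N => // n _ /=.
    have ss'0 : 0 < s' - s by rewrite subr_gt0.
    by apply: filterS (near_small_step 1 ss'0) => n /=; rewrite div1r.
  by apply: filterS => n nP s s' sD s'D; exact: nP.
apply: filterS sep => n nD.
have -> : (size D)%:R%:E = counting [set` D] :> \bar R.
  by rewrite /counting asboolT// set_fsetK.
rewrite (counting_cells n (subset_trans DT T01)); apply: lee_sum => k _.
have narrow s s' : s \in D -> s' \in D -> cell n k s -> cell n k s' -> s' <= s.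
  move=> sD s'D /andP[ks _] /andP[_ s'k]; rewrite leNgt; apply/negP => ss'.
  have := nD _ _ sD s'D ss'; rewrite ltNge => /negP; apply.
  by rewrite lerBlDr (le_trans s'k)// grid_pointS addrC lerD2l ltW.
apply: (le_trans (counting_le1 _)) => [s s' [sD sk] [s'D s'k]|].
  by apply/eqP; rewrite eq_le; apply/andP; split; apply: narrow.
case: asboolP => [[s [Ds sk]]|_]; last by case: ifP.
by rewrite asboolT//; exists s; split => //; exact: DT.
Qed.

Lemma cvg_occupied_cells T : T `<=` `]0, 1]%classic ->
  occupied_cells T n @[n --> \oo] --> counting T.
Proof.
move=> T01; have [finT|infT] := pselect (finite_set T).
  apply: cvg_near_cst.
  have DT : [set` fset_set T] `<=` T by rewrite fset_setK.
  apply: filterS (le_occupied_cells T01 DT) => n nT.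
  apply/eqP; rewrite eq_le occupied_cells_le//= (le_trans _ nT)//.
  by rewrite /counting asboolT.
rewrite /counting asboolF//; apply/cvgeyPge => M.
have [D DT MD] := infinite_set_fset (Num.truncn M).+1 infT.
apply: filterS (le_occupied_cells T01 DT) => n; apply: le_trans.
rewrite lee_fin; apply: le_trans (ltW (truncnS_gt M)) _.
by rewrite ler_nat.
Qed.

End counting_by_cells.

(** * The expected number of jumps *)

Section intensity.
Context {R : realType} {d : nat} {dO : measure_display}
  {Omega : measurableType dO}.
Variables (P : probability Omega R) (X : R -> Omega -> 'rV[R]_d).
Hypothesis hX : levy_process P X.
Variable nu : {measure set (borel 'rV[R]_d) -> \bar R}.
Hypothesis hnu : levy_measure P X nu.
Variable A : set 'rV[R]_d.
Hypotheses (FA : Fsigma A) (A0 : ~ A 0).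

Lemma Fsigma_borel : measurable (A : set (borel 'rV[R]_d)).
Proof.
have [F cF ->] := FA; apply: bigcupT_measurable => i; exact: borel_closed.
Qed.

Definition miss_probability h := fine (P (~` hit X 0 h A)).

Lemma measurable_hit a h : 0 <= a -> 0 < h -> measurable (hit X a (a + h) A).
Proof.
move=> a0 h0; have := (miss_Fsigma hX 1 FA A0 a0 h0).1.
by rewrite mul1r => /measurableC; rewrite setCK.
Qed.

Lemma probability_hit a h : 0 <= a -> 0 < h ->
  P (hit X a (a + h) A) = (1 - miss_probability h)%:E.
Proof.
move=> a0 h0; have mH := measurable_hit a0 h0.
have := (miss_Fsigma hX 1 FA A0 a0 h0).2.
rewrite mul1r expr1 -/(miss_probability h) => <-.
rewrite -[in LHS](setCK (hit _ _ _ _)) probability_setC; last exact: measurableC.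
by rewrite EFinB fineK ?fin_num_measure//; exact: measurableC.
Qed.

Lemma miss_probability_pow h m : 0 < h ->
  miss_probability (m%:R * h) = miss_probability h ^+ m.
Proof.
by move=> h0; have := (miss_Fsigma hX m FA A0 (lexx 0) h0).2; rewrite add0r.
Qed.

Lemma miss_probability_ge0 h : 0 <= miss_probability h.
Proof. exact/fine_ge0/measure_ge0. Qed.

Lemma miss_probability_le h h' : 0 <= h -> h <= h' ->
  miss_probability h' <= miss_probability h.
Proof.
move=> h0 hh'.
have mH k : 0 <= k -> measurable (~` hit X 0 k A).
  rewrite le_eqVlt => /predU1P[<-|k0].
    by have := (miss_Fsigma hX 0 FA A0 (lexx 0) ltr01).1; rewrite mul0r addr0.
  by have := measurable_hit (lexx 0) k0; rewrite add0r; exact: measurableC.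
apply: le_fine_probability; [by apply: mH; lra|exact: mH|].
move=> w; apply: contra_not => -[s [/andP[s0 sh] s1] As]; exists s => //.
by rewrite s0 (le_trans sh).
Qed.

Definition jump_set w : set R := [set s | jump_times X w 1 s /\ A (jump X w s)].

Lemma jump_set01 w : jump_set w `<=` `]0, 1]%classic.
Proof. by move=> s [[s01 _] _]; rewrite /= in_itv. Qed.

Lemma occupied_cells_jump_set w n : occupied_cells (jump_set w) n =
  (\sum_(k < n.+1) (\1_(hit X (grid_point 0 n.+1%:R^-1 k)
     (grid_point 0 n.+1%:R^-1 k + n.+1%:R^-1) A) w)%:E)%E.
Proof.
apply: eq_bigr => k _; rewrite indicE -grid_pointS.
have -> : `[< jump_set w `&` cell n k !=set0 >] =
    (w \in hit X (grid_point 0 n.+1%:R^-1 k) (grid_point 0 n.+1%:R^-1 k.+1) A).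
  apply/asboolP/idP => [[s [[[_ s0] As] sk]]|/set_mem[s [sk s0] As]].
    by apply/mem_set; exists s.
  exists s; split => //; split => //; split => //.
  have /andP[ks sk'] : cell n k s by [].
  apply/andP; split.
    by apply: le_lt_trans ks; rewrite /grid_point add0r mulr_ge0// invr_ge0.
  apply: (le_trans sk').
  by rewrite /grid_point add0r ler_pdivrMr// mul1r ler_nat.
by case: (_ \in _).
Qed.

Lemma measurable_occupied_cells n :
  measurable_fun setT (fun w => occupied_cells (jump_set w) n).
Proof.
under eq_fun do rewrite occupied_cells_jump_set.
apply: emeasurable_sum => k; apply/measurable_EFinP; apply: measurable_indic.
by apply: measurable_hit; rewrite ?invr_gt0// /grid_point add0r mulr_ge0// invr_ge0.
Qed.

Lemma integral_occupied_cells n : (\int[P]_w occupied_cells (jump_set w) n =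
  (n.+1%:R * (1 - miss_probability n.+1%:R^-1))%:E)%E.
Proof.
have g0 (k : nat) : 0 <= grid_point 0 n.+1%:R^-1 k :> R.
  by rewrite /grid_point add0r mulr_ge0// invr_ge0.
have mH (k : nat) : measurable (hit X (grid_point 0 n.+1%:R^-1 k)
    (grid_point 0 n.+1%:R^-1 k + n.+1%:R^-1) A).
  by apply: measurable_hit; rewrite ?invr_gt0.
under eq_integral do rewrite occupied_cells_jump_set.
rewrite ge0_integral_sum//; last first.
  by move=> k; apply/measurable_EFinP; exact: measurable_indic.
rewrite (eq_bigr (fun=> (1 - miss_probability n.+1%:R^-1)%:E)); last first.
  move=> k _; rewrite integral_indic// setIT.
  by apply: probability_hit; rewrite ?invr_gt0.
by rewrite sumEFin sumr_const card_ord mulr_natl.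
Qed.

Lemma cvg_jump_count w :
  occupied_cells (jump_set w) n @[n --> \oo] --> counting (jump_set w).
Proof. exact: cvg_occupied_cells (@jump_set01 w). Qed.

(** An occupied cell contains at least one jump. *)
Lemma intensity_ge n :
  ((n.+1%:R * (1 - miss_probability n.+1%:R^-1))%:E <= nu A)%E.
Proof.
rewrite -integral_occupied_cells (hnu Fsigma_borel); apply: ge0_le_integral => //.
- by move=> w _; apply: sume_ge0 => k _; case: ifP.
- exact: measurable_occupied_cells.
- apply: emeasurable_fun_cvg measurable_occupied_cells _ => w _.
  exact: cvg_jump_count.
- by move=> w _; apply: occupied_cells_le; exact: jump_set01.
Qed.

(** Fatou's lemma: the number of occupied cells tends to the number of jumps. *)
Lemma intensity_le l :
  (n.+1%:R * (1 - miss_probability n.+1%:R^-1))%:E @[n --> \oo] --> l ->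
  (nu A <= l)%E.
Proof.
move=> ul; rewrite (hnu Fsigma_borel).
rewrite -(cvg_limn_einf_sup ul).1.
have := @fatou _ _ _ P setT measurableT (fun n w => occupied_cells (jump_set w) n)
  measurable_occupied_cells.
have occ0 n w : setT w -> (0 <= occupied_cells (jump_set w) n)%E.
  by move=> _; apply: sume_ge0 => k _; case: ifP.
move=> /(_ occ0); rewrite (funext integral_occupied_cells).
apply: le_trans; rewrite le_eqVlt; apply/predU1P; left.
by apply: eq_integral => w _; rewrite (cvg_limn_einf_sup (@cvg_jump_count w)).1.
Qed.

Lemma intensityE l :
  (n.+1%:R * (1 - miss_probability n.+1%:R^-1))%:E @[n --> \oo] --> l ->
  nu A = l.
Proof.
move=> ul; apply/eqP; rewrite eq_le intensity_le//=.
by apply: cvge_to_le ul _; apply: nearW; exact: intensity_ge.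
Qed.

End intensity.

(** * The exponential law of hitting *)

Section exponential_law.
Context {R : realType}.

(** With [y = c / n], use [y - y ^+ 2 <= 1 - expR (- y) <= y]. *)
Lemma cvg_scaled_expR (c : R) : 0 <= c ->
  n.+1%:R * (1 - expR (- (c / n.+1%:R))) @[n --> \oo] --> c.
Proof.
move=> c0.
apply: (squeeze_cvgr (f := fun n => c - c * (c / n.+1%:R)) (h := fun=> c)); last 2 first.
- rewrite -[X in _ --> X]subr0; apply: cvgB; first exact: cvg_cst.
  rewrite -(mulr0 c); apply: cvgMr; apply/cvgrPdist_lt => e e0.
  apply: filterS (near_small_step c e0) => n.
  by rewrite sub0r normrN ger0_norm// divr_ge0.
- exact: cvg_cst.
apply: nearW => n; set y := c / n.+1%:R; have y0 : 0 <= y by rewrite divr_ge0.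
have ny : n.+1%:R * y = c by rewrite /y mulrC divfK// pnatr_eq0.
have lo : 1 - y <= expR (- y) by have := expR_ge1Dx (- y).
have hi : expR (- y) <= 1 - y + y * y.
  have := expR_ge1Dx y; have := expR_gt0 (- y); have := expRxMexpNx_1 y.
  move: (expR y) (expR (- y)) => E F EF F0 EY; nra.
have N0 : 0 <= n.+1%:R :> R by [].
rewrite -ny -mulrA -mulrBr; apply/andP; split; apply: ler_wpM2l => //; lra.
Qed.

(** Powers determine an antitone function at the rational multiples of 1, and
    antitonicity determines it in between. *)
Lemma exponential_of_antitone (g : R -> R) (c t : R) : 0 <= t -> 0 <= c ->
  (forall h, 0 <= g h) -> (forall h h', 0 <= h -> h <= h' -> g h' <= g h) ->
  (forall h m, 0 < h -> g (m%:R * h) = g h ^+ m) ->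
  g 1 = expR (- c) -> g t = expR (- (t * c)).
Proof.
move=> t0 c0 g0 gle gX g1.
have bounds n : expR (- c * (t + n.+1%:R^-1)) <= g t <= expR (- c * (t - n.+1%:R^-1)).
  set u := n.+1%:R^-1; have u0 : 0 < u by rewrite invr_gt0.
  have nu1 : n.+1%:R * u = 1 by rewrite divff// pnatr_eq0.
  have gu : g u = expR (- c * u).
    apply/eqP; rewrite -(@eqrXn2 _ n.+1)// ?expR_ge0// -gX// nu1 g1 -expRM_natl.
    by rewrite mulrCA nu1 mulr1.
  have /truncn_itv/andP[mt tm] : 0 <= t * n.+1%:R by rewrite mulr_ge0.
  move: mt tm; set m := Num.truncn _ => mt tm.
  have tE : t = t * n.+1%:R * u by rewrite -mulrA nu1 mulr1.
  have m0 : 0 <= m%:R * u by rewrite mulr_ge0// ltW.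
  have mut : m%:R * u <= t by rewrite [leRHS]tE ler_wpM2r// ltW.
  have tmu : t <= m.+1%:R * u by rewrite [leLHS]tE ler_wpM2r// ltW.
  apply/andP; split.
    apply: le_trans (gle _ _ t0 tmu); rewrite gX// gu -expRM_natl ler_expR.
    rewrite mulrCA !mulNr lerN2 ler_wpM2l//.
    by rewrite -natr1 mulrDl mul1r lerD2r.
  apply: le_trans (gle _ _ m0 mut) _; rewrite gX// gu -expRM_natl ler_expR.
  rewrite mulrCA !mulNr lerN2 ler_wpM2l// lerBlDr.
  by rewrite (le_trans tmu)// -natr1 mulrDl mul1r.
have gt0 : 0 < g t.
  by have /andP[+ _] := bounds 0%N; apply: lt_le_trans; exact: expR_gt0.
rewrite -[LHS]lnK ?posrE//; congr expR.
apply/eqP; rewrite -subr_eq0 opprK -normr_le0; apply/ler_addgt0Pr => e e0.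
have [n _ /(_ n (leqnn n)) cn] := near_small_step c e0.
have /andP[lo hi] : - c * (t + n.+1%:R^-1) <= ln (g t) <= - c * (t - n.+1%:R^-1).
  have gE : expR (ln (g t)) = g t by rewrite lnK.
  by move: (bounds n); rewrite -{1 2}gE !ler_expR.
rewrite add0r ler_norml; move: cn lo hi; rewrite !mulNr mulrDr mulrBr.
rewrite [t * c]mulrC; set u := c / _; set ct := c * t => cn lo hi.
by apply/andP; split; lra.
Qed.

End exponential_law.

Section hitting_probability.
Context {R : realType} {d : nat} {dO : measure_display}
  {Omega : measurableType dO}.
Variables (P : probability Omega R) (X : R -> Omega -> 'rV[R]_d).
Hypothesis hX : levy_process P X.
Variable nu : {measure set (borel 'rV[R]_d) -> \bar R}.
Hypothesis hnu : levy_measure P X nu.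

(** If [g 1 = 0] then [g] vanishes at all [1 / n], the expected numbers of
    occupied cells are [n], and [nu A] is infinite. Otherwise [nu A] is
    [- ln (g 1)]. *)
Lemma probability_hit_exp (A : set 'rV[R]_d) t : Fsigma A -> ~ A 0 -> 0 < t ->
  (P (hit X 0 t A) = 1 - expeR (- (t%:E * nu A)))%E.
Proof.
move=> FA A0 t0; pose g := miss_probability P X A.
have g0 h : 0 <= g h by exact: miss_probability_ge0.
have gX h m : 0 < h -> g (m%:R * h) = g h ^+ m.
  exact: (miss_probability_pow hX FA A0).
have gle h h' : 0 <= h -> h <= h' -> g h' <= g h.
  exact: (miss_probability_le hX FA A0).
have -> : P (hit X 0 t A) = (1 - g t)%:E.
  by have := probability_hit hX FA A0 (lexx 0) t0; rewrite add0r.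
have gn n : g n.+1%:R^-1 ^+ n.+1 = g 1.
  by rewrite -gX ?invr_gt0// divff// pnatr_eq0.
have g1 : g 1 <= 1.
  have := gle 0 1 (lexx 0) ler01.
  by have := gX 1 0%N ltr01; rewrite mul0r expr0 => ->.
have [g10|g10] := eqVneq (g 1) 0.
  have gn0 n : g n.+1%:R^-1 = 0.
    by apply/eqP; have /eqP := gn n; rewrite g10 expf_eq0 => /andP[].
  have -> : nu A = +oo%E.
    apply: (intensityE hX hnu FA A0); apply/cvgeyPge => M.
    near=> n; rewrite -/(g _) gn0 subr0 mulr1 lee_fin.
    rewrite (@le_trans _ _ n%:R)// ?ler_nat//; near: n; exact: nbhs_infty_ger.
  have -> : g t = 0.
    have [n _ /(_ n (leqnn n))] := near_small_step 1 t0; rewrite div1r => nt.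
    by apply/eqP; rewrite eq_le g0 andbT -(gn0 n) gle// ltW.
  by rewrite gt0_muley ?lte_fin// subr0 /= sube0.
pose c := - ln (g 1).
have g1E : g 1 = expR (- c) by rewrite opprK lnK// posrE lt_neqAle eq_sym g10 g0.
have c0 : 0 <= c by rewrite oppr_ge0 ln_le0.
have -> : nu A = c%:E.
  apply: (intensityE hX hnu FA A0); apply: cvg_EFin; first exact: nearW.
  rewrite (_ : _ \o _ = fun n => n.+1%:R * (1 - expR (- (c / n.+1%:R)))).
    exact: cvg_scaled_expR.
  apply/funext => n /=; congr (_ * (1 - _)); apply/eqP.
  rewrite -(@eqrXn2 _ n.+1)// ?expR_ge0// ?g0// gn g1E -expRM_natl mulrN.
  by rewrite mulrC divfK// pnatr_eq0.
by rewrite -EFinM /= (exponential_of_antitone (ltW t0) c0 g0 gle gX g1E).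
Unshelve. all: by end_near. Qed.

End hitting_probability.

(** * Orthants and boxes *)

Section Fsigma_sets.
Context {R : realType} {d : nat}.
Implicit Types (A B U : set 'rV[R]_d).

(** In a metric space an open set [U] is the increasing union of the closed sets
    of points at distance at least [1 / n] of its complement. *)
Lemma open_Fsigma U : open U -> Fsigma U.
Proof.
move=> oU; exists (fun n => ~` thickening (~` U) n.+1%:R^-1).
  by move=> n; apply: open_closedC; exact: open_thickening.
apply/seteqP; split=> [v Uv|v [n _ vn]]; last first.
  apply: contrapT => Uv; apply: vn; exists v => //.
  by rewrite subrr normr0 invr_gt0.
have /nbhs_ballP[e /= e0 eU] : nbhs v U by exact: open_nbhs_nbhs.
have [n _ /(_ n (leqnn n))] := near_small_step 1 e0; rewrite div1r => ne.
exists n => // -[y Uy vy]; apply: Uy; apply: eU.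
by rewrite -ball_normE/=; exact: lt_trans ne.
Qed.

Lemma locally_closed_Fsigma C U : closed C -> open U -> Fsigma (C `&` U).
Proof.
move=> cC /open_Fsigma[F cF ->]; exists (fun n => C `&` F n).
  by move=> n; exact: closedI.
by rewrite setI_bigcupr.
Qed.

End Fsigma_sets.

Section boxes.
Context {T : topologicalType} {n : nat}.
Implicit Types (B : 'I_n -> set T).

Lemma closed_rV_box B : (forall i, closed (B i)) ->
  closed [set v : 'rV[T]_n | forall i, B i (v ord0 i)].
Proof.
move=> cB v clv i; apply: cB => U vU.
pose V (_ : 'I_1) j := if j == i then U else setT.
have : nbhs v [set u : 'rV[T]_n | forall k j, V k j (u k j)].
  exists V => // k j; rewrite (ord1 k) /V.
  by case: eqP => [->//|_]; exact: filterT.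
move=> /clv[u [/(_ i) uB /(_ ord0 i)]]; rewrite /V eqxx => uU.
by exists (u ord0 i).
Qed.

Lemma open_rV_box B : (forall i, open (B i)) ->
  open [set v : 'rV[T]_n | forall i, B i (v ord0 i)].
Proof.
move=> oB; rewrite openE => v vB; exists (fun _ i => B i) => [k i|u uB i].
  by rewrite (ord1 k); apply: open_nbhs_nbhs.
exact: uB.
Qed.

Lemma open_rV_coord (i : 'I_n) (U : set T) :
  open U -> open [set v : 'rV[T]_n | U (v ord0 i)].
Proof.
move=> oU; rewrite openE => v Uv.
exists (fun _ j => if j == i then U else setT) => [k j|u /(_ ord0 i)].
  rewrite (ord1 k); case: eqP => [->|_]; last exact: filterT.
  exact: open_nbhs_nbhs.
by rewrite /= eqxx.
Qed.

End boxes.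

Section orthants.
Context {R : realType} {d : nat}.
Implicit Types (l v : 'rV[\bar R]_d).
Local Open Scope ereal_scope.

Lemma continuous_embed : continuous (@embed R d).
Proof.
move=> v B [V nV VB]; exists (fun i j => EFin @^-1` V i j).
  by move=> i j; apply/nbhs_EFin; have := nV i j; rewrite mxE.
by move=> u uV; apply: VB => i j; rewrite mxE; exact: uV.
Qed.

Lemma closed_orthant l : closed (orthant l).
Proof.
apply: (@closed_rV_box _ _ (fun i => [set y : \bar R |
  if 0 <= l ord0 i then 0 <= y else y <= 0])) => i /=.
case: (0 <= l ord0 i); first exact: closed_ereal_le_ereal.
exact: closed_ereal_ge_ereal.
Qed.

Lemma closed_filter_box l : closed (filter_box l).
Proof.
apply: (@closed_rV_box _ _ (fun i => ray (l ord0 i))) => i; rewrite /ray.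
case: (0 <= l ord0 i); first exact: closed_ereal_le_ereal.
exact: closed_ereal_ge_ereal.
Qed.

Lemma nbhs_lt (a : \bar R) (V : set (\bar R)) : -oo < a -> nbhs a V ->
  exists2 y, y < a & V y.
Proof.
case: a => [a _ /nbhs_EFin/nbhs_ballP[e /= e0 eV]|_ [M [_ MV]]|//].
  exists (a - e / 2)%R%:E.
    by rewrite lte_fin ltrBlDr ltrDl divr_gt0.
  apply: eV; rewrite /ball/= opprB addrC subrK ger0_norm ?divr_ge0 ?ltW//.
  by rewrite ltr_pdivrMr// ltr_pMr// ltr1n.
by exists (M + 1)%R%:E; rewrite ?ltry//; apply: MV; rewrite lte_fin ltrDl.
Qed.

Lemma nbhs_gt (a : \bar R) (V : set (\bar R)) : a < +oo -> nbhs a V ->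
  exists2 y, a < y & V y.
Proof.
case: a => [a _ /nbhs_EFin/nbhs_ballP[e /= e0 eV]|//|_ [M [_ MV]]].
  exists (a + e / 2)%R%:E.
    by rewrite lte_fin ltrDl divr_gt0.
  apply: eV; rewrite /ball/= opprD addNKr normrN ger0_norm ?divr_ge0 ?ltW//.
  by rewrite ltr_pdivrMr// ltr_pMr// ltr1n.
by exists (M - 1)%R%:E; rewrite ?ltNyr//; apply: MV; rewrite lte_fin ltrBlDr ltrDl.
Qed.

(** A point of the box with a coordinate equal to that of [l] is not interior:
    every neighbourhood of this coordinate extends beyond it, as it is not -oo
    when the ray goes up, nor +oo when the ray goes down. *)
Lemma box_intP l v : box_int l v <-> forall i,
  if 0 <= l ord0 i then l ord0 i < v ord0 i else v ord0 i < l ord0 i.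
Proof.
split=> [|lv]; last first.
  pose B i := [set y : \bar R |
    if 0 <= l ord0 i then l ord0 i < y else y < l ord0 i].
  have oB : open [set u : 'rV[\bar R]_d | forall i, B i (u ord0 i)].
    apply: open_rV_box => i; rewrite /B.
    case: (0 <= l ord0 i); first exact: open_ereal_gt_ereal.
    exact: open_ereal_lt_ereal.
  have : [set u : 'rV[\bar R]_d | forall i, B i (u ord0 i)] `<=` filter_box l.
    by move=> u uB i; have := uB i; rewrite /B /ray /=; case: ifP => _ /ltW.
  by rewrite (open_subsetE _ oB); apply.
move=> vl i; have vL : filter_box l v := interior_subset vl.
case: vl => V nV VL.
have move_coord y : V ord0 i y -> ray (l ord0 i) y.
  move=> Vy; pose u : 'rV[\bar R]_d := \row_j if j == i then y else v ord0 j.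
  suff /(_ i) : filter_box l u by rewrite mxE eqxx.
  apply: VL => k j; rewrite (ord1 k) mxE; case: eqP => [->//|_].
  exact: nbhs_singleton.
have := vL i; rewrite /ray /=; case: ifPn => l0; rewrite le_eqVlt => /predU1P[lv|//].
- have /nbhs_lt[|y yl] := nV ord0 i; first by rewrite -lv (lt_le_trans _ l0)// ltNyr.
  by move=> /move_coord; rewrite /ray /= l0 leNgt lv yl.
- have /nbhs_gt[|y yl] := nV ord0 i.
    by move: l0; rewrite -ltNge lv => /lt_trans; apply; rewrite ltry.
  by move=> /move_coord; rewrite /ray /= (negbTE l0) leNgt -lv yl.
Qed.

End orthants.

(** * Lower and upper records *)

Section hitting_embedded.
Context {R : realType} {d : nat} {dO : measure_display}
  {Omega : measurableType dO}.
Variables (P : probability Omega R) (X : R -> Omega -> 'rV[R]_d).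
Hypothesis hX : levy_process P X.
Implicit Types (C U : set 'rV[\bar R]_d) (A : set 'rV[R]_d) (t : R).

Lemma hit_neq0 a b A : hit X a b (A `\ 0) = hit X a b A.
Proof.
apply/seteqP; split=> w [s [sab js] As]; exists s => //; first by case: As.
by split => //; exact/eqP.
Qed.

(** The complement of a filter may contain the origin, in every neighbourhood of
    which there may be infinitely many jumps. No jump is zero, so removing the
    origin does not change the hits. *)
Lemma embed_locally_closed C U : closed C -> open U ->
  Fsigma ((embed @^-1` (C `&` U)) `\ (0 : 'rV[R]_d)).
Proof.
move=> cC oU; rewrite setDE preimage_setI -setIA.
apply: locally_closed_Fsigma.
  by apply: closed_comp => // v _; exact: continuous_embed.
apply: openI; last first.
  apply: closed_openC; apply: accessible_closed_set1.
  exact/hausdorff_accessible/norm_hausdorff.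
by apply: open_comp => // v _; exact: continuous_embed.
Qed.

Lemma measurable_hit_embed C U t : closed C -> open U -> 0 < t ->
  measurable (hit X 0 t (embed @^-1` (C `&` U))).
Proof.
move=> cC oU t0; have := embed_locally_closed cC oU => FA.
have A0 : ~ ((embed @^-1` (C `&` U)) `\ 0) (0 : 'rV[R]_d) by case=> _; exact.
by have := measurable_hit hX FA A0 (lexx 0) t0; rewrite add0r hit_neq0.
Qed.

Variable nu : {measure set (borel 'rV[R]_d) -> \bar R}.
Hypothesis hnu : levy_measure P X nu.

Lemma probability_hit_embed C U t : closed C -> open U -> 0 < t ->
  (P (hit X 0 t (embed @^-1` (C `&` U))) =
   1 - expeR (- (t%:E * extend nu (C `&` U))))%E.
Proof.
move=> cC oU t0; have := embed_locally_closed cC oU => FA.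
have A0 : ~ ((embed @^-1` (C `&` U)) `\ 0) (0 : 'rV[R]_d) by case=> _; exact.
rewrite -hit_neq0 (probability_hit_exp hX hnu FA A0 t0) /extend.
have mA : measurable (embed @^-1` (C `&` U) : set (borel 'rV[R]_d)).
  rewrite preimage_setI; apply: measurableI.
    by apply: borel_closed; apply: closed_comp => // v _; exact: continuous_embed.
  by apply: borel_open; apply: open_comp => // v _; exact: continuous_embed.
have mA' := Fsigma_borel FA.
do 4 congr (_ _); rewrite (hnu mA) (hnu mA').
congr (_ * _)%E; apply: eq_integral => w _; congr counting.
apply/seteqP; split=> s [js As]; split=> //; first by case: As.
by split => //; case: js => _ /eqP.
Qed.

End hitting_embedded.

Section records.
Context {R : realType} {d : nat} {dO : measure_display}
  {Omega : measurableType dO}.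
Variables (P : probability Omega R) (X : R -> Omega -> 'rV[R]_d).
Hypothesis hX : levy_process P X.
Variables (l : 'rV[\bar R]_d) (t : R).
Hypothesis t0 : 0 < t.
Local Open Scope ereal_scope.
Implicit Types (B : set 'rV[\bar R]_d) (w : Omega).

Lemma orthant_jumpsP B w :
  (exists2 x, orthant_jumps X l t w x & B x) <->
  hit X 0 t (embed @^-1` (orthant l `&` B)) w.
Proof.
split=> [[_ [[s js <-] ls] Bs]|[s js [ls Bs]]]; first by exists s.
by exists (embed (jump X w s)) => //; split => //; exists s.
Qed.

Let J w := orthant_jumps X l t w.

Lemma inf_jumps_ltP i w a : ereal_inf [set x ord0 i | x in J w] < a <->
  hit X 0 t (embed @^-1` (orthant l `&` [set x | x ord0 i < a])) w.
Proof.
rewrite -orthant_jumpsP; split=> [/ereal_inf_ltP[_ [x Jx <-] xa]|[x Jx xa]].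
  by exists x.
by apply/ereal_inf_ltP; exists (x ord0 i) => //; exists x.
Qed.

Lemma sup_jumps_gtP i w a : a < ereal_sup [set x ord0 i | x in J w] <->
  hit X 0 t (embed @^-1` (orthant l `&` [set x | a < x ord0 i])) w.
Proof.
rewrite -orthant_jumpsP; split=> [/ereal_sup_gtP[_ [x Jx <-] xa]|[x Jx xa]].
  by exists x.
by apply/ereal_sup_gtP; exists (x ord0 i) => //; exists x.
Qed.

Lemma measurable_inf_jumps i :
  measurable_fun setT (fun w => ereal_inf [set x ord0 i | x in J w]).
Proof.
apply: (measurability _ (ErealGenInftyO.measurableE R)) => _ /= -[_ [r ->] <-].
rewrite setTI (_ : _ @^-1` _ =
    hit X 0 t (embed @^-1` (orthant l `&` [set x | x ord0 i < r%:E]))).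
  apply: (measurable_hit_embed hX) => //; first exact: closed_orthant.
  exact: (@open_rV_coord _ _ i [set y | y < r%:E]
    (@open_ereal_lt_ereal R r%:E)).
by apply/seteqP; split=> w; rewrite /= in_itv/= => /inf_jumps_ltP.
Qed.

Lemma measurable_sup_jumps i :
  measurable_fun setT (fun w => ereal_sup [set x ord0 i | x in J w]).
Proof.
apply: (measurability _ (ErealGenOInfty.measurableE R)) => _ /= -[_ [r ->] <-].
rewrite setTI (_ : _ @^-1` _ =
    hit X 0 t (embed @^-1` (orthant l `&` [set x | r%:E < x ord0 i]))).
  apply: (measurable_hit_embed hX) => //; first exact: closed_orthant.
  exact: (@open_rV_coord _ _ i [set y | r%:E < y]
    (@open_ereal_gt_ereal R r%:E)).
by apply/seteqP; split=> w; rewrite /= in_itv/= andbT => /sup_jumps_gtP.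
Qed.

Lemma measurable_lower_record : measurable_fun setT (lower_record X l t).
Proof.
apply: measurable_rV_ereal => i; under eq_fun do rewrite mxE.
by case: (0 <= l ord0 i); [exact: measurable_inf_jumps|exact: measurable_sup_jumps].
Qed.

Lemma ereal_sup_setU0 (S : set (\bar R)) : ereal_sup (0 |` S) = maxe 0 (ereal_sup S).
Proof.
apply/eqP; rewrite eq_le; apply/andP; split.
  apply/ereal_supP => y [->|Sy]; first by rewrite le_max lexx.
  by rewrite le_max ereal_sup_ubound ?orbT.
rewrite ge_max; apply/andP; split; first by apply: ereal_sup_ubound; left.
by apply: ereal_sup_le => y; right.
Qed.

Lemma ereal_inf_setU0 (S : set (\bar R)) : ereal_inf (0 |` S) = mine 0 (ereal_inf S).
Proof.
apply/eqP; rewrite eq_le; apply/andP; split.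
  rewrite le_min; apply/andP; split; first by apply: ereal_inf_lbound; left.
  by apply: ereal_inf_le_tmp => y; right.
apply/ereal_infP => y [->|Sy]; first by rewrite ge_min lexx.
by rewrite ge_min ereal_inf_lbound ?orbT.
Qed.

Lemma measurable_upper_record : measurable_fun setT (upper_record X l t).
Proof.
apply: measurable_rV_ereal => i; under eq_fun do rewrite mxE.
case: (0 <= l ord0 i).
  under eq_fun do rewrite ereal_sup_setU0.
  by apply: measurable_maxe => //; exact: measurable_sup_jumps.
under eq_fun do rewrite ereal_inf_setU0.
by apply: measurable_mine => //; exact: measurable_inf_jumps.
Qed.

Lemma lower_record_orthant w : orthant l (lower_record X l t w).
Proof.
move=> i; rewrite mxE; have [l0|l0] := boolP (0 <= l ord0 i).
  by apply/ereal_infP => _ [x [_ lx] <-]; have := lx i; rewrite l0.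
by apply/ereal_supP => _ [x [_ lx] <-]; have := lx i; rewrite (negbTE l0).
Qed.

Lemma upper_record_orthant w : orthant l (upper_record X l t w).
Proof.
move=> i; rewrite mxE; have [l0|l0] := boolP (0 <= l ord0 i).
  by apply: ereal_sup_ubound; left.
by apply: ereal_inf_lbound; left.
Qed.

(** An infimum is strictly below a bound if and only if one of the values is,
    and dually for a supremum. *)
Lemma lower_record_compl : lower_record X l t @^-1` box_compl l =
  hit X 0 t (embed @^-1` box_compl l).
Proof.
apply/seteqP; split=> w; rewrite /box_compl setDE => /=; last first.
  move=> /orthant_jumpsP[x Jx xl]; split; first exact: lower_record_orthant.
  apply: contra_not xl => rl i; have := rl i; rewrite /ray /= mxE.
  have Jxi : [set y ord0 i | y in J w] (x ord0 i) by exists x.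
  case: (0 <= l ord0 i) => {}rl; first exact: le_trans rl (ereal_inf_lbound Jxi).
  exact: le_trans (ereal_sup_ubound Jxi) rl.
move=> [_ /existsNP[i]]; rewrite /ray /= mxE => rl.
apply/orthant_jumpsP; move: rl.
have [l0|l0] := boolP (0 <= l ord0 i); move=> /negP; rewrite -ltNge.
- move=> /inf_jumps_ltP/orthant_jumpsP[x Jx xl]; exists x => // /(_ i).
  by rewrite /ray /= l0 leNgt xl.
- move=> /sup_jumps_gtP/orthant_jumpsP[x Jx xl]; exists x => // /(_ i).
  by rewrite /ray /= (negbTE l0) leNgt xl.
Qed.

Lemma box_int_orthant v : box_int l v -> orthant l v.
Proof.
move=> /box_intP lv i; have := lv i; case: ifPn => [l0 /ltW|l0 /lt_trans vl].
  exact: le_trans.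
by apply/ltW/vl; rewrite ltNge.
Qed.

Lemma upper_record_box_int w :
  hit X 0 t (embed @^-1` box_int l) w -> box_int l (upper_record X l t w).
Proof.
move=> [s js sl]; have Js : J w (embed (jump X w s)).
  by split; [exists s|exact: box_int_orthant].
apply/box_intP => i; move/box_intP : sl => /(_ i).
move: Js; set x := embed _ => Js.
rewrite [upper_record _ _ _ _ _ _]mxE.
have [l0|l0] := boolP (0 <= l ord0 i); move=> sl.
  by apply: lt_le_trans sl _; apply: ereal_sup_ubound; right; exists x.
by apply: le_lt_trans sl; apply: ereal_inf_lbound; right; exists x.
Qed.

(** Each coordinate of the record comes from one jump. The composition of these
    finitely many jumps lies in [box_int l], so the semi-character vanishes on
    it, hence on one of the jumps. The record itself may be the composition of
    infinitely many jumps, to which multiplicativity does not apply. *)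
Lemma box_int_upper_record (S : set 'rV[\bar R]_d) w : (0 < d)%N ->
  subsemigroup (tstar l) (orthant l) S -> J w `<=` S ->
  semi_character (tstar l) S (\1_(box_int_compl l) : _ -> R) ->
  box_int l (upper_record X l t w) ->
  hit X 0 t (embed @^-1` box_int l) w.
Proof.
move=> d0 [Sl Sop] JS [_ chiM] /box_intP rl.
have /choice[x xP] (i : 'I_d) : exists x, J w x /\
    if 0 <= l ord0 i then l ord0 i < x ord0 i else x ord0 i < l ord0 i.
  have := rl i; rewrite mxE; have [l0|l0] := boolP (0 <= l ord0 i).
    rewrite ereal_sup_setU0 lt_max ltNge l0 /= => /ereal_sup_gtP[_ [x Jx <-] lx].
    by exists x.
  rewrite ereal_inf_setU0 gt_min => /orP[/ltW|]; first by rewrite (negbTE l0).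
  by move=> /ereal_inf_ltP[_ [x Jx <-] lx]; exists x.
pose i0 := Ordinal d0.
pose y (s : seq 'I_d) := foldr (fun i => tstar l (x i)) (x i0) s.
have Sx i : S (x i) by apply: JS; exact: (xP i).1.
have Sy s : S (y s) by elim: s => [|i s IH] /=; [exact: Sx|exact: Sop].
have yl s i : i \in s ->
    if 0 <= l ord0 i then l ord0 i < y s ord0 i else y s ord0 i < l ord0 i.
  elim: s => [//|j s IH]; rewrite inE /= !mxE.
  case/predU1P => [<-|/IH {}IH].
    by have := (xP i).2; case: ifP => _ lx; rewrite ?lt_max ?gt_min lx.
  by move: IH; case: ifP => _ ly; rewrite ?lt_max ?gt_min ly orbT.
have /box_intP yint i : if 0 <= l ord0 i then l ord0 i < y (enum 'I_d) ord0 i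
    else y (enum 'I_d) ord0 i < l ord0 i by apply: yl; rewrite mem_enum.
have chi_y s : (\1_(box_int_compl l) (y s) : R)%R = 0%R -> exists i, box_int l (x i).
  have chi0 i : (\1_(box_int_compl l) (x i) : R)%R = 0%R -> box_int l (x i).
    rewrite indicE; case: (boolP (_ \in _)) => [_ /eqP|]; first by rewrite oner_eq0.
    move=> /negP xi _; apply: contrapT => xl; apply: xi; apply/mem_set.
    by split => //; exact: Sl.
  elim: s => [/chi0|i s IH]; first by exists i0.
  rewrite /= chiM// => /eqP; rewrite mulf_eq0 => /orP[/eqP/chi0|/eqP/IH//].
  by exists i.
have [|i xi] := chi_y (enum 'I_d).
  by rewrite indicE memNset// => -[].
have [[[s js xE] _] _] := xP i.
by exists s => //=; rewrite xE.
Qed.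

Lemma measurable_hit_box_int :
  measurable (hit X 0 t (embed @^-1` box_int l)).
Proof.
rewrite -(setTI (box_int l)); apply: (measurable_hit_embed hX) => //.
exact: open_interior.
Qed.

End records.

(** * Hazard functions *)

Section hazard_density.
Context {R : realType} {d : nat} {dO : measure_display}
  {Omega : measurableType dO}.
Variables (P : probability Omega R) (rho : Omega -> borel 'rV[\bar R]_d).
Hypothesis mrho : measurable_fun setT rho.
Variables (E K : set 'rV[\bar R]_d) (y : \bar R).
Hypotheses (mK : measurable (K : set (borel 'rV[\bar R]_d))).
Local Open Scope ereal_scope.
Hypotheses (y0 : 0 <= y) (rhoK : rho @^-1` K = ~` (rho @^-1` E))
  (mE : measurable (rho @^-1` E)) (PE : P (rho @^-1` E) = 1 - expeR (- y)).

(** Here [y] stands for [t * nu E] and may be infinite: then [K] is null for the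
    law of [rho], and the density is infinite on it. *)
Lemma law_complement : pushforward P rho K = expeR (- y).
Proof.
rewrite /pushforward rhoK probability_setC// PE.
by case: y y0 => [r| |]//= _; rewrite ?sube0 ?subee// -!EFinB opprB addrC subrK.
Qed.

Lemma exponential_density_hazard x :
  exponential_density P \1_K rho x = hazard (pushforward P rho) K x.
Proof.
rewrite /exponential_density /hazard muleC; congr (_^-1 * _).
rewrite (_ : \1_K \o rho = \1_(rho @^-1` K)).
  by rewrite expectation_indic// rhoK; exact: measurableC.
by apply/funext => w; rewrite /= !indicE.
Qed.

Lemma hazardE x : hazard (pushforward P rho) K x = expeR y * (\1_K x)%:E.
Proof.
rewrite /hazard law_complement; congr (_ * _).
case: y y0 => [r| |]//= _; last by rewrite inve0.
by rewrite expRN inver invr_eq0 gt_eqF ?expR_gt0// invrK.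
Qed.

Lemma integral_hazard : y < +oo ->
  \int[pushforward P rho]_x hazard (pushforward P rho) K x = 1.
Proof.
move=> yoo; under eq_integral do rewrite hazardE.
have mI : measurable_fun setT (fun x : borel 'rV[\bar R]_d => (\1_K x)%:E : \bar R).
  exact/measurable_EFinP/measurable_indic.
rewrite ge0_integral_pushforward//; last 2 first.
- by apply: measurable_funeM.
- by move=> x _; rewrite mule_ge0// expeR_ge0.
rewrite preimage_setT /comp ge0_integralZl//; last 2 first.
- exact: measurableT_comp mI mrho.
- exact: expeR_ge0.
under eq_integral do rewrite -[\1_K (rho _)]/(\1_(rho @^-1` K) _).
rewrite integral_indic//; last by rewrite rhoK; exact: measurableC.
rewrite setIT; transitivity (expeR y * expeR (- y)).
  by congr (_ * _); exact: law_complement.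
by rewrite -expeRD subee ?ge0_fin_numE// expeR0.
Qed.

End hazard_density.

Lemma semi_character_box {R : realType} {d : nat} (l : 'rV[\bar R]_d) :
  semi_character (star l) (orthant l) (\1_(filter_box l) : _ -> R).
Proof.
split=> [x _|x y _ _]; first by rewrite indicE.
rewrite !indicE -natrM mulnb; congr (_%:R); congr nat_of_bool.
apply/idP/andP => [/set_mem xyl|[/set_mem xl /set_mem yl]].
  by split; apply/mem_set => i; have := xyl i; rewrite /ray /= mxE;
    case: (0 <= l ord0 i)%E; rewrite ?le_min ?ge_max => /andP[].
apply/mem_set => i; have := xl i; have := yl i; rewrite /ray /= mxE.
by case: (0 <= l ord0 i)%E; rewrite ?le_min ?ge_max => -> ->.
Qed.

Unset Implicit Arguments.

Local Open Scope ereal_scope.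

Theorem lemma3p3 (R : realType) (d : nat) (dO : measure_display)
    (Omega : measurableType dO) (P : probability Omega R)
    (X : R -> Omega -> 'rV[R]_d)
    (nu : {measure set (borel 'rV[R]_d) -> \bar R})
    (t : R) (l : 'rV[\bar R]_d)
    (hd : (0 < d)%N) (hX : levy_process P X) (hnu : levy_measure P X nu)
    (ht : (0 < t)%R) :
  (let mu := lower_law P X l t in
   let L := filter_box l in
   let Lc := box_compl l in
   [/\ measurable_fun [set: Omega] (lower_record X l t),
       mu Lc = hitting P X t Lc /\
         hitting P X t Lc = 1 - expeR (- (t%:E * extend nu Lc)),
       semi_character (star l) (orthant l) \1_L,
       forall x, [/\ exponential_density P \1_L (lower_record X l t) x =
                       hazard mu L x &
                     hazard mu L x =
                       expeR (t%:E * extend nu Lc) * (\1_L x)%:E]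
     & extend nu Lc < +oo -> \int[mu]_x hazard mu L x = 1]) /\
  (let mu := upper_law P X l t in
   let Li := box_int l in
   let Lic := box_int_compl l in
   measurable_fun [set: Omega] (upper_record X l t) /\
   forall S : set 'rV[\bar R]_d,
     subsemigroup (tstar l) (orthant l) S ->
     {ae P, forall w, forall u, orthant_jumps X l u w `<=` S} ->
     semi_character (tstar l) S \1_Lic ->
     [/\ mu Li = hitting P X t Li /\
           hitting P X t Li = 1 - expeR (- (t%:E * extend nu Li)),
         forall x, [/\ exponential_density P \1_Lic (upper_record X l t) x =
                         hazard mu Lic x &
                       hazard mu Lic x =
                         expeR (t%:E * extend nu Li) * (\1_Lic x)%:E]
       & extend nu Li < +oo -> \int[mu]_x hazard mu Lic x = 1]).
Proof.
have y0 (A : set 'rV[\bar R]_d) : 0 <= t%:E * extend nu A.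
  by apply: mule_ge0; [rewrite lee_fin ltW|exact: measure_ge0].
have yoo (A : set 'rV[\bar R]_d) : extend nu A < +oo -> t%:E * extend nu A < +oo.
  by move=> nuA; rewrite lte_mul_pinfty// lee_fin ltW.
split=> /=.
- have oLc : open (~` filter_box l) by exact/closed_openC/closed_filter_box.
  have mR := measurable_lower_record hX l ht.
  have lawE := lower_record_compl X l t.
  have mE : measurable (lower_record X l t @^-1` box_compl l).
    rewrite lawE /box_compl setDE.
    by apply: (measurable_hit_embed hX) => //; exact: closed_orthant.
  have hitE : hitting P X t (box_compl l) =
      1 - expeR (- (t%:E * extend nu (box_compl l))).
    rewrite /box_compl setDE; apply: (probability_hit_embed hX hnu) => //.
    exact: closed_orthant.
  have PE : P (lower_record X l t @^-1` box_compl l) =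
      1 - expeR (- (t%:E * extend nu (box_compl l))) by rewrite lawE.
  have rhoK : lower_record X l t @^-1` filter_box l =
      ~` (lower_record X l t @^-1` box_compl l).
    apply/seteqP; split=> w /= => [lw [_]//|lw]; apply: contrapT => nlw.
    by apply: lw; split => //; exact: lower_record_orthant.
  have mK : measurable (filter_box l : set (borel 'rV[\bar R]_d)).
    by apply: borel_closed; exact: closed_filter_box.
  split => //.
  + by split; rewrite // /lower_law /pushforward lawE.
  + exact: semi_character_box.
  + move=> x; split; first exact: (exponential_density_hazard P rhoK mE).
    exact: (hazardE (y0 _) rhoK mE PE).
  + by move=> /yoo; exact: (integral_hazard mR mK (y0 _) rhoK mE PE).
- have mR := measurable_upper_record hX l ht; split=> // S Ssub JS chi.
  have mH := measurable_hit_box_int hX l ht.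
  have mI : measurable (box_int l : set (borel 'rV[\bar R]_d)).
    by apply: borel_open; exact: open_interior.
  have mE : measurable (upper_record X l t @^-1` box_int l).
    by rewrite -[X in measurable X]setTI; exact: mR.
  have lawE : P (upper_record X l t @^-1` box_int l) = hitting P X t (box_int l).
    (* The two events differ by a null set, where some jump is not in [S]. *)
    have [N [mN PN0 JN]] := JS.
    apply/eqP; rewrite eq_le; apply/andP; split; last first.
      apply: le_measure; rewrite ?inE// => w; exact: upper_record_box_int.
    have UN : upper_record X l t @^-1` box_int l `<=`
        hit X 0 t (embed @^-1` box_int l) `|` N.
      move=> w /= lw; have [Nw|Nw] := pselect (N w); first by right.
      left; apply: box_int_upper_record hd Ssub _ chi lw.
      by apply: (contrapT _); move=> JSw; apply: Nw; apply: JN => /(_ t).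
    apply: (@le_trans _ _ (P (hit X 0 t (embed @^-1` box_int l) `|` N))).
      by apply: le_measure; rewrite ?inE//; exact: measurableU.
    by rewrite (le_trans (measureU2 _ mH mN))// [X in _ + X]PN0 adde0.
  have hitE : hitting P X t (box_int l) = 1 - expeR (- (t%:E * extend nu (box_int l))).
    rewrite -(setTI (box_int l)); apply: (probability_hit_embed hX hnu) => //.
    exact: open_interior.
  have PE := etrans lawE hitE.
  have rhoK : upper_record X l t @^-1` box_int_compl l =
      ~` (upper_record X l t @^-1` box_int l).
    apply/seteqP; split=> w /= => [[_]//|lw].
    by split => //; exact: upper_record_orthant.
  have mK : measurable (box_int_compl l : set (borel 'rV[\bar R]_d)).
    apply: borel_closed; rewrite /box_int_compl setDE; apply: closedI.
      exact: closed_orthant.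
    by apply: open_closedC; exact: open_interior.
  split.
  + by split.
  + move=> x; split; first exact: (exponential_density_hazard P rhoK mE).
    exact: (hazardE (y0 _) rhoK mE PE).
  + by move=> /yoo; exact: (integral_hazard mR mK (y0 _) rhoK mE PE).
Qed.
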